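(* Let $k$ be an algebraically closed field of characteristic $p>0$, and let $G=G_k$ be one of the classical groups (types CG1, CG2, CG3) described in the context, with Lie algebra $\mathfrak g$ and natural representation $(\nu,\mathcal L\otimes_{\mathbb Z}k)$. Suppose that $p$ is good for $G_k$ (i.e. $p\ne 2$ in case CG2 or CG3). For each nilpotent $X\in\mathfrak g$ with $p$-nilpotence degree $n$, the Artin–Hasse exponential $$\vec t=(t_0,\dots,t_{n-1})\mapsto F(t_0\,d\nu(X))\,F(t_1\,d\nu(X)^p)\cdots F(t_{n-1}\,d\nu(X)^{p^{n-1}})$$ defines an injective morphism of algebraic groups $E_X:\mathbb W_n\to G_k$. Thus each unipotent element of $G$ lies in a closed subgroup isomorphic with some $\mathbb W_n$. If $l$ is a subfield of $k$ and $X\in\mathfrak g_l$, then $E_X$ is defined over $l$.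
   Context: Classical groups: let $V$ be a finite dimensional $\mathbb Q$-vector space with a bilinear form $\varphi$, and let $G_{\mathbb Q}$ be the stabilizer of $\varphi$ in $\mathrm{SL}(V)$, where one of the following holds: CG1: $\varphi=0$, so $G_{\mathbb Q}=\mathrm{SL}(V)$; CG2: $\varphi$ is non-degenerate alternating, so $G_{\mathbb Q}=\mathrm{Sp}(V,\varphi)$; CG3: $\varphi$ is non-degenerate symmetric, so $G_{\mathbb Q}=\mathrm{SO}(V,\varphi)$, and writing $\dim V=2r+\epsilon$ with $\epsilon\in\{0,1\}$, $V$ contains a totally singular subspace of dimension $r$ (split form). The dimension of $V$ is such that $G_{\mathbb Q}$ is a connected, quasisimple, split group. Let $\mathfrak g_{\mathbb Q}$ be its Lie algebra and $\mathcal L\subset V$ a lattice invariant under Kostant's $\mathbb Z$-form of the enveloping algebra of $\mathfrak g_{\mathbb Q}$; in cases CG2, CG3 scale $\varphi$ so that $\varphi(\mathcal L,\mathcal L)=\mathbb Z$. The Chevalley construction with $(V,\mathcal L)$ gives a quasisimple $\mathbb F_p$-split group $G_{\mathbb F_p}\le\mathrm{GL}(\mathcal L/p\mathcal L)$ with the same root datum as $G_{\mathbb Q}$; for $p$ as in the claim it is the stabilizer in $\mathrm{SL}(\mathcal L/p\mathcal L)$ of the (zero, resp. non-degenerate) form induced by $\varphi$. $G_k$ is obtained from $G_{\mathbb F_p}$ by extension of scalars to $k$. For a subfield $l\subset k$, $\mathfrak g_l=\operatorname{Lie}(G_{\mathbb F_p})\otimes_{\mathbb F_p}l$. The $p$-nilpotence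 degree of $X$ is the least $n\ge 0$ with $X^{[p^n]}=0$ (iterated $p$-power map). $\mathbb W_n$ is the algebraic group over $k$ of Witt vectors of length $n$ for the prime $p$. The Artin–Hasse series is $F(t)=\exp\!\big(-(t+t^p/p+t^{p^2}/p^2+\cdots)\big)$, which has coefficients in $\mathbb Z_{(p)}$, so may be evaluated (by reduction mod $p$) at nilpotent endomorphisms over $k$. *)

(* Defs.v *)
From HB Require Import structures.
From mathcomp Require Import all_boot all_order all_algebra.
From mathcomp Require Import mpoly.

Set Implicit Arguments.
Unset Strict Implicit.
Unset Printing Implicit Defensive.

Import Order.TTheory GRing.Theory Num.Theory.
Local Open Scope ring_scope.

(* A basis of the lattice L identifies L with Z^d (column vectors), V with    *)
(* Q^d, L (x) R with R^d, and the form phi with an integral Gram matrix Phi.  *)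

Definition bform d (Phi : 'M[int]_d) (R : comNzRingType) (u v : 'cV[R]_d) : R :=
  (u^T *m map_mx intr Phi *m v) 0 0.

Definition stabSL d (Phi : 'M[int]_d) (R : comNzRingType) (g : 'M[R]_d) : Prop :=
  \det g = 1 /\
  forall u v : 'cV[R]_d, bform Phi (g *m u) (g *m v) = bform Phi u v.

(* The Lie algebra of the group scheme R |-> stabSL Phi R, as the kernel of   *)
(* stabSL (R[eps]) -> stabSL R, where R[eps] = R[x]/(x^2) and eps = 'qX.      *)
Definition Lie d (Phi : 'M[int]_d) (R : comNzRingType) (X : 'M[R]_d) : Prop :=
  @stabSL d Phi {poly %/ ('X^2 : {poly R})}
    (1%:M + 'qX *: map_mx (fun a : R => in_qpoly 'X^2 a%:P) X).

(* Lie(G_{F_p}) (x) l, for l of characteristic p, as matrices over l.         *)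
Definition Lie_Fp_ext d (Phi : 'M[int]_d) (p : nat) (l : fieldType)
    (X : 'M[l]_d) : Prop :=
  exists m (c : 'I_m -> l) (Y : 'I_m -> 'M['F_p]_d),
    (forall i, Lie Phi (Y i)) /\
    X = \sum_i c i *: map_mx (fun a : 'F_p => (a : nat)%:R) (Y i).

Definition lie_bracket (R : comNzRingType) d (A B : 'M[R]_d) : 'M[R]_d :=
  A *m B - B *m A.

(* (x_a) is the family of root vectors of a Chevalley basis of g_Q relative   *)
(* to the split Cartan subalgebra T; rt a is the root of x_a (only its values *)
(* on T matter), and [x_a, x_{-a}] is the coroot of a.                        *)
Record chevalley_system d (Phi : 'M[int]_d) (T : {vspace 'M[rat]_d})
    (I : finType) (x : I -> 'M[rat]_d) (rt : I -> 'M[rat]_d -> rat) : Prop := {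
  chev_decomp : forall X : 'M[rat]_d,
    Lie Phi X <-> X \in (T + <<[seq x a | a : I]>>)%VS;
  chev_abelian : forall s t, s \in T -> t \in T -> lie_bracket s t = 0;
  chev_neq0 : forall a, x a != 0;
  chev_root : forall a t, t \in T -> lie_bracket t (x a) = rt a t *: x a;
  chev_root_neq0 : forall a, exists2 t, t \in T & rt a t != 0;
  chev_root_inj : forall a b, a != b -> exists2 t, t \in T & rt a t != rt b t;
  chev_coroot : forall a a', (forall t, t \in T -> rt a' t = - rt a t) ->
    lie_bracket (x a) (x a') \in T /\ rt a (lie_bracket (x a) (x a')) = 2;
  chev_const : forall a b c a' b' c' (r : rat),
    (forall t, t \in T ->
      [/\ rt c t = rt a t + rt b t, rt a' t = - rt a t,
          rt b' t = - rt b t & rt c' t = - rt c t]) ->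
    lie_bracket (x a) (x b) = r *: x c ->
    lie_bracket (x a') (x b') = - r *: x c' }.

(* Kostant's Z-form of U(g_Q) is generated by the divided powers x_a^m / m!   *)
(* of the root vectors of a Chevalley basis.                                  *)
Definition kostant_invariant_lattice d (Phi : 'M[int]_d) : Prop :=
  exists (T : {vspace 'M[rat]_d}) (I : finType) (x : I -> 'M[rat]_d)
         (rt : I -> 'M[rat]_d -> rat),
    chevalley_system Phi T x rt /\
    forall a m, m`!%:R^-1 *: x a ^+ m \is a mxOver Num.int.

Inductive classical_type := typeSL | typeSp | typeSO.

Definition nondegenerate_form d (Phi : 'M[int]_d) : Prop :=
  forall u : 'cV[rat]_d, (forall v, bform Phi u v = 0) -> u = 0.

Definition alternating_form d (Phi : 'M[int]_d) : Prop :=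
  forall u : 'cV[rat]_d, bform Phi u u = 0.

Definition symmetric_form d (Phi : 'M[int]_d) : Prop :=
  forall u v : 'cV[rat]_d, bform Phi u v = bform Phi v u.

Definition split_form d (Phi : 'M[int]_d) : Prop :=
  exists2 U : {vspace 'cV[rat]_d}, \dim U = d./2 &
    forall u v, u \in U -> v \in U -> bform Phi u v = 0.

(* phi (L, L) = Z; the inclusion in Z holds since Phi is integral.            *)
Definition form_onto_Z d (Phi : 'M[int]_d) : Prop :=
  forall m : int, exists u v : 'cV[int]_d, bform Phi u v = m.

(* The bounds on d express that G_Q is connected and quasisimple: SL_1 and    *)
(* SO_1 are trivial, SO_2 is a torus, and SO_4 has type A_1 x A_1.            *)
Definition classical_datum (c : classical_type) d (Phi : 'M[int]_d) : Prop :=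
  kostant_invariant_lattice Phi /\
  match c with
  | typeSL => (2 <= d)%N /\ Phi = 0
  | typeSp => [/\ (2 <= d)%N, nondegenerate_form Phi, alternating_form Phi
                & form_onto_Z Phi]
  | typeSO => [/\ (d == 3) || (5 <= d)%N, nondegenerate_form Phi,
                  symmetric_form Phi, split_form Phi & form_onto_Z Phi]
  end.

Definition good_prime (c : classical_type) (p : nat) : Prop :=
  match c with typeSL => True | _ => p <> 2%N end.

Definition nilpotent_mx (R : comNzRingType) d (X : 'M[R]_d) : Prop :=
  exists m : nat, X ^+ m = 0.

Definition unipotent_mx (R : comNzRingType) d (u : 'M[R]_d) : Prop :=
  nilpotent_mx (u - 1%:M).

Definition p_nilpotence_degree (p : nat) (R : comNzRingType) d (X : 'M[R]_d)
    (n : nat) : Prop :=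
  X ^+ (p ^ n)%N = 0 /\ forall m : nat, X ^+ (p ^ m)%N = 0 -> (n <= m)%N.

(* On the subring Z_(p) of rat this is reduction mod p into a field of        *)
(* characteristic p; it is only ever applied to elements of Z_(p).            *)
Definition red_rat (k : fieldType) (q : rat) : k := (numq q)%:~R / (denq q)%:~R.

Definition ghost (p : nat) (R : comNzRingType) (m : nat) (z : nat -> R) : R :=
  \sum_(i < m.+1) (p ^ i)%:R * z i ^+ (p ^ (m - i)).

Definition witt_x (n : nat) (i : nat) : {mpoly rat[n + n]} :=
  oapp (fun i' : 'I_n => 'X_(lshift n i')) 0 (insub i).

Definition witt_y (n : nat) (i : nat) : {mpoly rat[n + n]} :=
  oapp (fun i' : 'I_n => 'X_(rshift n i')) 0 (insub i).

(* The polynomials S_0, ..., S_(j-1) giving Witt vector addition, determined  *)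
(* by  ghost m S = ghost m x + ghost m y.                                     *)
Fixpoint witt_sum (p n j : nat) : seq {mpoly rat[n + n]} :=
  if j is m.+1 then
    let S := witt_sum p n m in
    rcons S ((p ^ m)%:R^-1 *:
      (ghost p m (witt_x n) + ghost p m (witt_y n)
       - \sum_(i < m) (p ^ i)%:R * S`_i ^+ (p ^ (m - i))))
  else [::].

(* W_n is the affine space 'rV[k]_n with the following group law.             *)
Definition witt_add (k : fieldType) (p n : nat) (s t : 'rV[k]_n) : 'rV[k]_n :=
  \row_(j < n)
    (map_mpoly (red_rat k) (witt_sum p n n)`_j).@[fun i => row_mx s t 0 i].

(* The coefficient of t^m in F(t) = exp(- (t + t^p/p + t^(p^2)/p^2 + ...));   *)
(* the omitted terms of both series only contribute in degrees > m.           *)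
Definition artin_hasse_coef (p m : nat) : rat :=
  (\sum_(j < m.+1) j`!%:R^-1 *:
     (- \sum_(i < m.+1) (p ^ i)%:R^-1 *: 'X^(p ^ i)) ^+ j : {poly rat})`_m.

(* F(N) for a nilpotent N, for which N ^+ d = 0.                              *)
Definition artin_hasse (k : fieldType) (p d : nat) (N : 'M[k]_d) : 'M[k]_d :=
  \sum_(m < d) red_rat k (artin_hasse_coef p m) *: N ^+ m.

Definition artin_hasse_exp (k : fieldType) (p d n : nat) (X : 'M[k]_d)
    (t : 'rV[k]_n) : 'M[k]_d :=
  \prod_(i < n) artin_hasse p (t 0 i *: X ^+ (p ^ i)%N).

Definition regular_on (k : fieldType) m n (A : 'rV[k]_m -> Prop)
    (f : 'rV[k]_m -> 'rV[k]_n) : Prop :=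
  exists P : 'I_n -> {mpoly k[m]},
    forall x, A x -> forall i, f x 0 i = (P i).@[fun j => x 0 j].

(* Closed in the space of matrices, hence in GL_d when S consists of          *)
(* invertible matrices; for S contained in SL_d the two notions agree.        *)
Definition zariski_closed (k : fieldType) d (S : 'M[k]_d -> Prop) : Prop :=
  exists I : {mpoly k[d * d]} -> Prop,
    forall g, S g <-> forall f, I f -> f.@[fun j => mxvec g 0 j] = 0.

Definition closed_subgroup (k : fieldType) d (G H : 'M[k]_d -> Prop) : Prop :=
  [/\ forall g, H g -> G g, zariski_closed H, H 1%:M,
      forall g h, H g -> H h -> H (g *m h) & forall g, H g -> H (invmx g)].

Definition witt_morphism (k : fieldType) (p n d : nat) (G : 'M[k]_d -> Prop)
    (E : 'rV[k]_n -> 'M[k]_d) : Prop :=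
  [/\ forall t, G (E t),
      regular_on (fun _ => True) (fun t => mxvec (E t)) &
      forall s t, E (witt_add p s t) = E s *m E t].

Definition witt_isomorphic (k : fieldType) (p n d : nat)
    (H : 'M[k]_d -> Prop) : Prop :=
  exists (E : 'rV[k]_n -> 'M[k]_d) (E' : 'M[k]_d -> 'rV[k]_n),
    [/\ witt_morphism p H E, cancel E E', forall g, H g -> E (E' g) = g &
        regular_on (fun x => H (vec_mx x)) (fun x => E' (vec_mx x))].

Definition defined_over (l k : fieldType) (iota : {rmorphism l -> k}) (n d : nat)
    (E : 'rV[k]_n -> 'M[k]_d) : Prop :=
  exists P : 'I_d -> 'I_d -> {mpoly l[n]},
    forall t i j, E t i j = (map_mpoly iota (P i j)).@[fun h => t 0 h].

(* Main.v *)
Require Import Defs.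
From HB Require Import structures.
From mathcomp Require Import all_boot all_order all_algebra.
From mathcomp Require Import mpoly.
From mathcomp Require Import finfield ring zify.

(* Modulo T^N, a power series over a Q-algebra with constant term 1 is        *)
(* determined by its logarithmic derivative for T d/dT.  That of F(t T^q), q  *)
(* a power of p, is explicit, so that the identity                            *)
(*   prod_i F(S_i T^(p^i)) = prod_i F(x_i T^(p^i)) prod_i F(y_i T^(p^i))      *)
(* reduces to the equality of ghost components defining the Witt sum S, and   *)
(* F(T)^p exp(pT) = F(T^p) gives the p-integrality of F by Dwork's argument.  *)
(* Comparing the coefficients of T^(p^m) in the product identity then gives   *)
(* the p-integrality of S_m, and one may reduce mod p and put T = X.          *)
(*   For p odd F(-T) = 1/F(T), whence E_X(t) preserves the form.  As          *)
(* E_X(t) = E_X(t_0,...,t_(i-1),0,...) - t_i X^(p^i) + O(X^(p^i + 1)), the    *)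
(* t_i are recovered recursively as polynomials in the entries of E_X(t);     *)
(* this yields the injectivity of E_X and the closedness of its image.        *)
(* Finally F - 1 has a compositional inverse, so a unipotent u of the group   *)
(* is F(X) = E_X(1, 0, ..., 0) for some nilpotent X skew for the form.        *)

Set Implicit Arguments.
Unset Strict Implicit.
Unset Printing Implicit Defensive.

Import Order.TTheory GRing.Theory Num.Theory.
Local Open Scope ring_scope.

(** All identities are proved between polynomials modulo a power of T, and a nilpotent X is
    substituted for T only at the end: E_X(t) is the value at X of [witt_prod], the product of the
    F(t_i T^(p^i)) ([artin_hasse_exp_horner]), and a congruence modulo T^N becomes an equality as
    soon as X^N = 0 ([horner_mx_congX]).

    The homomorphism property is [AHk_witt_add]. Over Q it says that Witt addition adds ghost
    components, because the logarithmic derivative of the product is minus the sum of the ghost_m(t)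
    T^(p^m) ([AH_prod_ghost]). It passes to k because both F ([artin_hasse_plocal]) and the addition
    polynomials ([witt_sum_int]) have coefficients in Z_(p).

    The values lie in G for two reasons. If P(0) = 1, then P(X) has p-power order, so its
    determinant is a p-power root of unity in characteristic p, that is, 1 ([det_expp]). If X is in
    the Lie algebra, then X^T Phi = - Phi X ([Lie_skew]), so P(X) preserves the form once P(-T) P(T)
    = 1; this holds for p odd since log F is then an odd series ([AHk_oppr], [horner_stabSL]).

    Injectivity and closedness both follow from a polynomial left inverse r of E_X
    ([artin_hasse_exp_inverse]): the image is the locus where E_X o r fixes g
    ([artin_hasse_exp_image]). For u unipotent in G, X is obtained by applying the inverse series of
    F - 1 to u - 1, and uniqueness of that inverse makes X skew ([unipotent_artin_hasse]). *)

(** * Congruences modulo X^N and logarithmic derivatives *)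

Section Truncation.
Variable R : comNzRingType.
Implicit Types P Q H : {poly R}.

(** Truncated power series are handled as polynomials with an explicit cofactor: this form passes
    directly through products, compositions and evaluation at a matrix, while [congXP] gives the
    coefficientwise reading. *)
Definition congX N P Q := exists D, P = Q + D * 'X^N.

Lemma congXP N P Q : (forall i, (i < N)%N -> P`_i = Q`_i) <-> congX N P Q.
Proof.
split=> [ePQ | [D ->] i ltiN]; last by rewrite coefD coefMXn ltiN addr0.
exists (drop_poly N (P - Q)).
rewrite -[LHS](subrKC Q); congr (_ + _); apply/polyP=> i.
rewrite coefMXn coef_drop_poly; case: ltnP => [ltiN | leNi].
  by rewrite coefB ePQ ?subrr.
by rewrite subnK.
Qed.

Lemma congXxx N P : congX N P P.
Proof. by apply/congXP. Qed.

Lemma congX_sym N P Q : congX N P Q -> congX N Q P.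
Proof. by move=> /congXP ePQ; apply/congXP=> i ltiN; rewrite ePQ. Qed.

Lemma congX_trans N Q P H : congX N P Q -> congX N Q H -> congX N P H.
Proof.
by move=> /congXP ePQ /congXP eQH; apply/congXP=> i ltiN; rewrite ePQ ?eQH.
Qed.

Lemma congX_leq M N P Q : (M <= N)%N -> congX N P Q -> congX M P Q.
Proof.
move=> leMN /congXP ePQ; apply/congXP=> i ltiM.
by rewrite ePQ // (leq_trans ltiM).
Qed.

Lemma congXD N P Q P' Q' :
  congX N P Q -> congX N P' Q' -> congX N (P + P') (Q + Q').
Proof.
move=> /congXP eP /congXP eP'; apply/congXP=> i ltiN.
by rewrite !coefD eP ?eP'.
Qed.

Lemma congXN N P Q : congX N P Q -> congX N (- P) (- Q).
Proof. by move=> /congXP eP; apply/congXP=> i ltiN; rewrite !coefN eP. Qed.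

Lemma congXMn N P Q n : congX N P Q -> congX N (P *+ n) (Q *+ n).
Proof. by move=> /congXP eP; apply/congXP=> i ltiN; rewrite !coefMn eP. Qed.

Lemma congXM N P Q P' Q' :
  congX N P Q -> congX N P' Q' -> congX N (P * P') (Q * Q').
Proof.
move=> [D ->] [D' ->]; exists (Q * D' + D * (Q' + D' * 'X^N)).
by rewrite mulrDl mulrDr !mulrDl -!addrA !mulrA; congr (_ + (_ + _));
  rewrite mulrAC -?mulrA.
Qed.

Lemma congX_sum N (I : Type) (r : seq I) (A : pred I) (F G : I -> {poly R}) :
  (forall i, A i -> congX N (F i) (G i)) ->
  congX N (\sum_(i <- r | A i) F i) (\sum_(i <- r | A i) G i).
Proof.
move=> eFG; elim/big_rec2: _ => [|i P Q Ai]; first exact: congXxx.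
by apply: congXD; apply: eFG.
Qed.

Lemma congX_prod N (I : Type) (r : seq I) (A : pred I) (F G : I -> {poly R}) :
  (forall i, A i -> congX N (F i) (G i)) ->
  congX N (\prod_(i <- r | A i) F i) (\prod_(i <- r | A i) G i).
Proof.
move=> eFG; elim/big_rec2: _ => [|i P Q Ai]; first exact: congXxx.
by apply: congXM; apply: eFG.
Qed.

Lemma congX_Xn0 N m P : (N <= m)%N -> congX N (P * 'X^m) 0.
Proof.
by move=> leNm; exists (P * 'X^(m - N)); rewrite add0r -mulrA -exprD subnK.
Qed.

Lemma congX_comp N P Q H :
  congX N P Q -> congX N (P \Po (H * 'X)) (Q \Po (H * 'X)).
Proof.
move=> [D ->]; exists ((D \Po (H * 'X)) * H ^+ N).
by rewrite comp_polyD comp_polyM rmorphXn /= comp_polyX exprMn mulrA.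
Qed.

Lemma congX_XM0 (H : {poly R}) N j :
  (N <= j)%N -> congX N ((H * 'X) ^+ j) 0.
Proof. by move=> leNj; rewrite exprMn; apply: congX_Xn0. Qed.

Lemma congXX N (P Q : {poly R}) j :
  congX N P Q -> congX N (P ^+ j) (Q ^+ j).
Proof.
move=> e; elim: j => [|j IH]; first exact: congXxx.
by rewrite !exprS; apply: congXM.
Qed.

Lemma congXZ N (P Q : {poly R}) a :
  congX N P Q -> congX N (a *: P) (a *: Q).
Proof. by move=> /congXP eP; apply/congXP=> i ltiN; rewrite !coefZ eP. Qed.

Lemma congX_sum_tail (f : nat -> {poly R}) M N K :
    (M <= N)%N -> (forall i, (M <= i)%N -> congX K (f i) 0) ->
  congX K (\sum_(i < N) f i) (\sum_(i < M) f i).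
Proof.
move=> leMN f0; rewrite -!(big_mkord predT) (big_cat_nat (leq0n M) leMN) /=.
rewrite -[X in congX _ _ X]addr0; apply: congXD; first exact: congXxx.
apply: (@congX_trans _ (\sum_(M <= i < N) 0)); last by rewrite big1_eq; exact: congXxx.
rewrite !big_seq; apply: congX_sum => i; rewrite mem_index_iota => /andP[leMi _].
exact: f0.
Qed.

Definition theta P := 'X * P^`().

Lemma coef_theta P i : (theta P)`_i = P`_i *+ i.
Proof. by rewrite coefXM; case: i => [|i]; rewrite ?mulr0n // coef_deriv. Qed.

Lemma thetaM P Q : theta (P * Q) = theta P * Q + P * theta Q.
Proof. by rewrite /theta derivM mulrDr mulrA [P * (_ * _)]mulrCA. Qed.

Lemma congX_theta N P Q : congX N P Q -> congX N (theta P) (theta Q).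
Proof. by move=> /congXP eP; apply/congXP=> i ?; rewrite !coef_theta eP. Qed.

Lemma theta_comp_Xn P c q :
  theta (P \Po (c *: 'X^q)) = (theta P \Po (c *: 'X^q)) *+ q.
Proof.
rewrite /theta deriv_comp derivZ derivXn comp_polyM comp_polyX.
rewrite mulrCA [LHS]mulrC -mulrnAl; congr (_ * _); rewrite -scalerAr scalerMnr.
by congr (_ *: _); case: q => [|q]; rewrite ?mulr0n ?mulr0 // mulrnAr exprS.
Qed.

(* [logder N H G] says that [H] is the logarithmic derivative of [G] for the  *)
(* derivation [T d/dT], modulo [T^N].                                         *)
Definition logder N H P := congX N (theta P) (H * P).

Lemma logderM N H H' P P' :
  logder N H P -> logder N H' P' -> logder N (H + H') (P * P').
Proof.
move=> dP dP'; rewrite /logder thetaM mulrDl mulrA [H' * (P * P')]mulrCA.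
by apply: congXD; apply: congXM => //; apply: congXxx.
Qed.

Lemma logder1 N : logder N 0 1.
Proof. by rewrite /logder /theta derivC mulr0 mul0r; apply: congXxx. Qed.

Lemma logder_prod N (I : Type) (r : seq I) (A : pred I) (F G : I -> {poly R}) :
  (forall i, A i -> logder N (F i) (G i)) ->
  logder N (\sum_(i <- r | A i) F i) (\prod_(i <- r | A i) G i).
Proof.
move=> eFG; elim/big_rec2: _ => [|i P Q Ai]; first exact: logder1.
by apply: logderM; apply: eFG.
Qed.

Lemma logderX N H P n : logder N H P -> logder N (H *+ n) (P ^+ n).
Proof.
move=> dP; elim: n => [|n IH]; first exact: logder1.
by rewrite mulrS exprS; apply: logderM.
Qed.

Lemma logder_congX N H H' P : congX N H H' -> logder N H P -> logder N H' P.
Proof.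
by move=> eH dP; apply: congX_trans dP _; apply: congXM => //; apply: congXxx.
Qed.

Lemma logder_congXr N H P P' : congX N P P' -> logder N H P -> logder N H P'.
Proof.
move=> eP dP; apply: congX_trans (congX_theta (congX_sym eP)) _.
by apply: congX_trans dP _; apply: congXM => //; apply: congXxx.
Qed.

Lemma logder_leq M N H P : (M <= N)%N -> logder N H P -> logder M H P.
Proof. exact: congX_leq. Qed.

Lemma logder_comp N H P c q : (0 < q)%N -> logder N H P ->
  logder N ((H \Po (c *: 'X^q)) *+ q) (P \Po (c *: 'X^q)).
Proof.
case: q => // q _ dP; rewrite /logder theta_comp_Xn mulrnAl -comp_polyM.
by apply: congXMn; rewrite exprSr scalerAl; apply: congX_comp.
Qed.

(** In degree i+1 the equation reads (i+1) P_(i+1) = sum of H_j P_(i+1-j). As H_0 = 0, the right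
    side involves only lower coefficients of P, and i+1 can be cancelled. *)
Lemma logder_inj N H P P' :
    (forall n (x : R), x *+ n.+1 = 0 -> x = 0) ->
    H`_0 = 0 -> P`_0 = P'`_0 ->
  logder N H P -> logder N H P' -> congX N P P'.
Proof.
move=> R0 H0 eP0 /congXP dP /congXP dP'; apply/congXP.
elim/ltn_ind=> -[//|i] IH ltiN.
apply/eqP; rewrite -subr_eq0; apply/eqP/(R0 i).
rewrite mulrnBl -!coef_theta dP // dP' // !coefM -sumrB big1 // => j _.
case: j => [[|j] ltj] /=; first by rewrite H0 !mul0r subrr.
rewrite IH ?subrr ?(leq_ltn_trans _ ltiN) //; first by rewrite subSS ltnS leq_subr.
by rewrite leq_subr.
Qed.

End Truncation.

(** * The local ring Z_(p) and its reduction modulo p *)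

Definition plocal_pred (p : nat) (x : rat) : bool := coprime p `|denq x|.
Arguments plocal_pred p x /.
Definition plocal (p : nat) := [qualify a x : rat | plocal_pred p x].

Lemma plocalE p x : (x \is a plocal p) = coprime p `|denq x|.
Proof. by []. Qed.

Lemma denq_dvd (a b : int) : b != 0 -> (denq (a%:~R / b%:~R) %| b)%Z.
Proof.
move=> b0; set x : rat := _ / _.
have e : numq x * b = a * denq x.
  apply: (@intr_inj rat); rewrite !rmorphM /=.
  have d0 : (denq x)%:~R != 0 :> rat by rewrite intr_eq0 denq_neq0.
  have b0' : b%:~R != 0 :> rat by rewrite intr_eq0.
  apply: (mulIf (invr_neq0 d0)); rewrite mulfK // mulrAC divq_num_den.
  by rewrite /x divfK.
have : (denq x %| numq x * b)%Z by rewrite e dvdz_mull.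
by rewrite Gauss_dvdzr // /coprimez /gcdz /= gcdnC (eqP (coprime_num_den x)).
Qed.

Lemma plocal_frac p (a b : int) :
  b != 0 -> coprime p `|b| -> a%:~R / b%:~R \is a plocal p.
Proof.
move=> b0 cpb; rewrite plocalE; apply: coprime_dvdr cpb.
exact: denq_dvd.
Qed.

Fact plocal_subring_closed p : subring_closed (plocal p).
Proof.
split=> [|x y|x y]; first by rewrite plocalE coprimen1.
  rewrite !plocalE => cx cy.
  have -> : x - y = (numq x * denq y - numq y * denq x)%:~R
                    / (denq x * denq y)%:~R.
    rewrite -[in LHS](divq_num_den x) -[in LHS](divq_num_den y).
    rewrite !rmorphB !rmorphM /=.
    by field; rewrite !intr_eq0 !denq_neq0.
  apply: plocal_frac; first by rewrite mulf_neq0 ?denq_neq0.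
  by rewrite abszM coprimeMr cx.
rewrite !plocalE => cx cy.
have -> : x * y = (numq x * numq y)%:~R / (denq x * denq y)%:~R.
  rewrite -[in LHS](divq_num_den x) -[in LHS](divq_num_den y) !rmorphM /=.
  by field; rewrite !intr_eq0 !denq_neq0.
apply: plocal_frac; first by rewrite mulf_neq0 ?denq_neq0.
by rewrite abszM coprimeMr cx.
Qed.

HB.instance Definition _ p :=
  GRing.isSubringClosed.Build rat (plocal_pred p) (@plocal_subring_closed p).

(** [red_rat] is not additive on all of [rat]. With Z_(p) as a ring in its own right, the inclusion
    into Q and the reduction to k are both ring morphisms, and polynomial identities can be carried
    along them. *)
Record Zp_loc (p : nat) :=
  ZpLoc { Zp_val :> rat; Zp_valP : Zp_val \is a plocal p }.

HB.instance Definition _ p := [isSub for @Zp_val p].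
HB.instance Definition _ p := [Choice of Zp_loc p by <:].
HB.instance Definition _ p := [SubChoice_isSubComNzRing of Zp_loc p by <:].

HB.instance Definition _ p :=
  GRing.RMorphism.copy (@Zp_val p) (val : Zp_loc p -> rat).

Section Reduction.
Variables (p : nat) (k : fieldType).

Definition Zp_red of p \in [pchar k] := fun x : Zp_loc p => red_rat k (val x).

Hypothesis hp : p \in [pchar k].

Lemma intr_pchar_eq0 (z : int) : (z%:~R == 0 :> k) = (p %| `|z|)%N.
Proof.
rewrite (dvdn_pcharf hp) {1}[z]intEsign rmorphM /= rmorph_sign.
by rewrite mulf_eq0 signr_eq0.
Qed.

Lemma pcharf_coprime_neq0 (b : int) : coprime p `|b| -> b%:~R != 0 :> k.
Proof. by rewrite intr_pchar_eq0 -prime_coprime // (pcharf_prime hp). Qed.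

Lemma red_rat_frac (a b : int) : coprime p `|b| -> b != 0 ->
  red_rat k (a%:~R / b%:~R) = a%:~R / b%:~R.
Proof.
move=> cb b0; rewrite /red_rat; set x : rat := _ / _.
have cx : coprime p `|denq x| by apply: coprime_dvdr cb; apply: denq_dvd.
have /(congr1 (fun z : int => z%:~R : k)) : numq x * b = a * denq x.
  apply: (@intr_inj rat); rewrite !rmorphM /=.
  have d0 : (denq x)%:~R != 0 :> rat by rewrite intr_eq0 denq_neq0.
  have b0' : b%:~R != 0 :> rat by rewrite intr_eq0.
  apply: (mulIf (invr_neq0 d0)); rewrite mulfK // mulrAC divq_num_den.
  by rewrite /x divfK.
rewrite !rmorphM /= => e.
apply/eqP; rewrite eqr_div ?pcharf_coprime_neq0 //; exact/eqP.
Qed.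

Fact Zp_red_is_zmod_morphism : zmod_morphism (Zp_red hp).
Proof.
move=> [x cx] [y cy]; rewrite /Zp_red /=.
rewrite !plocalE in cx cy.
have -> : x - y = (numq x * denq y - numq y * denq x)%:~R
                    / (denq x * denq y)%:~R.
  rewrite -[in LHS](divq_num_den x) -[in LHS](divq_num_den y).
  rewrite !rmorphB !rmorphM /=.
  by field; rewrite !intr_eq0 !denq_neq0.
rewrite red_rat_frac ?mulf_neq0 ?denq_neq0 ?abszM ?coprimeMr ?cx //.
rewrite /red_rat !rmorphB !rmorphM /=.
by field; rewrite !pcharf_coprime_neq0.
Qed.

Fact Zp_red_is_monoid_morphism : monoid_morphism (Zp_red hp).
Proof.
split=> [|[x cx] [y cy]]; first by rewrite /Zp_red /red_rat /= divr1.
rewrite /Zp_red /=; rewrite !plocalE in cx cy.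
have -> : x * y = (numq x * numq y)%:~R / (denq x * denq y)%:~R.
  rewrite -[in LHS](divq_num_den x) -[in LHS](divq_num_den y) !rmorphM /=.
  by field; rewrite !intr_eq0 !denq_neq0.
rewrite red_rat_frac ?mulf_neq0 ?denq_neq0 ?abszM ?coprimeMr ?cx //.
rewrite /red_rat !rmorphM /=.
by field; rewrite !pcharf_coprime_neq0.
Qed.

HB.instance Definition _ := GRing.isZmodMorphism.Build (Zp_loc p) k (Zp_red hp)
  Zp_red_is_zmod_morphism.
HB.instance Definition _ := GRing.isMonoidMorphism.Build (Zp_loc p) k (Zp_red hp)
  Zp_red_is_monoid_morphism.

(** The denominator is invertible in k, so p divides the numerator; dividing it by p keeps the
    denominator prime to p. *)
Lemma Zp_red_eq0 (x : Zp_loc p) : Zp_red hp x = 0 -> exists y, x = p%:R * y.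
Proof.
have pp := pcharf_prime hp.
case: x => x cx; rewrite /Zp_red /red_rat /= => /eqP.
rewrite mulf_eq0 invr_eq0 (negPf (pcharf_coprime_neq0 cx)) orbF => nx0.
have /dvdzP[q e] : (p%:Z %| numq x)%Z.
  by rewrite dvdzE /= -intr_pchar_eq0.
have cy : q%:~R / (denq x)%:~R \is a plocal p.
  by apply: plocal_frac; rewrite ?denq_neq0.
exists (ZpLoc cy); apply: val_inj; rewrite rmorphM rmorph_nat /=.
rewrite -[LHS]divq_num_den e rmorphM /=.
by field; rewrite intr_eq0 denq_neq0.
Qed.

End Reduction.

(** * The truncated exponential and Artin-Hasse series over Q *)

Definition pow_sum (R : comNzRingType) (p N : nat) : {poly R} :=
  \sum_(i < N) 'X^(p ^ i).

Section TruncatedExp.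
Implicit Types L : {poly rat}.

Definition texp N L : {poly rat} := \sum_(j < N) j`!%:R^-1 *: L ^+ j.

Lemma texp_congX M N L L' (H : {poly rat}) : (M <= N)%N -> L' = H * 'X ->
  congX M L L' -> congX M (texp N L) (texp M L').
Proof.
move=> leMN eH eL; apply: (@congX_trans _ _ (texp N L')).
  by apply: congX_sum => j _; apply/congXZ/congXX.
apply: (congX_sum_tail (f := fun j => j`!%:R^-1 *: L' ^+ j)) => // i leMi.
rewrite -[X in congX _ _ X](scaler0 _ i`!%:R^-1).
apply: congXZ; rewrite eH; exact: congX_XM0.
Qed.

(** Differentiation drops the last term of a truncated exponential. For [texp N.+1 L] the
    discrepancy is a multiple of [theta L * L ^+ N], which is divisible by X^(N+1) because L has no
    constant term. *)
Lemma texp_logder N (H : {poly rat}) :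
  logder N (theta (H * 'X)) (texp N (H * 'X)).
Proof.
case: N => [|N]; first by apply/congXP.
set L := H * 'X.
have thX j : theta (L ^+ j) = (theta L * L ^+ j.-1) *+ j.
  by rewrite /theta deriv_exp mulrnAr mulrA.
rewrite /logder; have -> : theta (texp N.+1 L) = theta L * texp N L.
  rewrite /texp big_ord_recl /= {1}/theta derivD raddf_sum mulrDr.
  rewrite derivZ expr0 derivC scaler0 mulr0 add0r !mulr_sumr.
  apply: eq_bigr => j _; rewrite /= derivZ -scalerAr -/(theta _) thX -scalerAr.
  rewrite -scalerMnr scalerMnl; congr (_ *: _).
  by rewrite -mulr_natr factS natrM invfM mulrAC mulVf ?mul1r // pnatr_eq0.
rewrite [texp N.+1 L]/texp big_ord_recr /= -/(texp N L) mulrDr.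
rewrite -[X in congX _ X _]addr0; apply: congXD; first exact: congXxx.
rewrite -scalerAr -[X in congX _ X _](scaler0 _ N`!%:R^-1); apply: congXZ.
have -> : theta L * L ^+ N = L^`() * H ^+ N * 'X^(N.+1).
  by rewrite /theta {2}/L exprMn exprS; ring.
exact/congX_sym/congX_Xn0.
Qed.
End TruncatedExp.

Section ArtinHasse.
Variable p : nat.
Hypothesis p_gt1 : (1 < p)%N.

Definition AH N : {poly rat} := \poly_(m < N) artin_hasse_coef p m.

Definition AHlog N : {poly rat} := - \sum_(i < N) (p ^ i)%:R^-1 *: 'X^(p ^ i).

Lemma AHlogX N : AHlog N = (- \sum_(i < N) (p ^ i)%:R^-1 *: 'X^((p ^ i).-1)) * 'X.
Proof.
rewrite mulNr mulr_suml; congr (- _); apply: eq_bigr => i _.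
by rewrite -scalerAl -exprSr prednK // expn_gt0 ltnW.
Qed.

Lemma congX_AHlog M N : (M <= N)%N -> congX M (AHlog N) (AHlog M).
Proof.
move=> leMN; apply: congXN.
apply: (congX_sum_tail (f := fun i => (p ^ i)%:R^-1 *: 'X^(p ^ i))) => // i leMi.
rewrite -mul_polyC; apply: congX_Xn0.
by rewrite (leq_trans leMi) // ltnW // ltn_expl.
Qed.

Lemma congX_AH N : congX N (AH N) (texp N (AHlog N)).
Proof.
apply/congXP=> m ltmN; rewrite coef_poly ltmN.
rewrite /artin_hasse_coef -/(AHlog m.+1) -/(texp m.+1 _).
have /congXP : congX m.+1 (texp N (AHlog N)) (texp m.+1 (AHlog m.+1)).
  by apply: texp_congX (AHlogX _) (congX_AHlog _).
by move=> ->.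
Qed.

Lemma theta_AHlog N : theta (AHlog N) = - pow_sum rat p N.
Proof.
rewrite /theta derivN mulrN raddf_sum mulr_sumr; congr (- _).
apply: eq_bigr => i _; rewrite /= derivZ derivXn -scalerAr mulrnAr.
rewrite -exprS prednK ?expn_gt0 ?(ltnW p_gt1) // -scaler_nat scalerA mulVf.
  by rewrite scale1r.
by rewrite pnatr_eq0 -lt0n expn_gt0 ltnW.
Qed.

Lemma AH_logder N : logder N (- pow_sum rat p N) (AH N).
Proof.
apply: logder_congXr (congX_sym (congX_AH N)) _.
rewrite -theta_AHlog AHlogX; exact: texp_logder.
Qed.

Lemma AH_coef0 N : (0 < N)%N -> (AH N)`_0 = 1.
Proof.
move=> N0; rewrite coef_poly N0 /artin_hasse_coef !big_ord1.
by rewrite expr0 /= invr1 scale1r coefC.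
Qed.

Lemma pow_sumS (R : comNzRingType) N :
  pow_sum R p N.+1 = 'X + (pow_sum R p N \Po 'X^p).
Proof.
rewrite /pow_sum big_ord_recl expn0 expr1 raddf_sum; congr (_ + _).
by apply: eq_bigr => i _; rewrite /= rmorphXn /= comp_polyX -exprM -expnS.
Qed.

Lemma pow_sum_coef0 (R : comNzRingType) N : (pow_sum R p N)`_0 = 0.
Proof.
rewrite coef_sum big1 // => i _.
by rewrite coefXn ltn_eqF // expn_gt0 ltnW.
Qed.

Lemma pow_sum_coef1 (R : comNzRingType) N : (0 < N)%N -> (pow_sum R p N)`_1 = 1.
Proof.
case: N => // N _; rewrite pow_sumS coefD coefX eqxx coef_comp_poly_Xn ?(ltnW p_gt1) //.
by rewrite dvdn1 gtn_eqF // addr0.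
Qed.

Lemma AH_coef1 N : (1 < N)%N -> (AH N)`_1 = -1.
Proof.
move=> N1; have /congXP/(_ 1 N1) := AH_logder N.
rewrite coef_theta mulr1n => ->.
rewrite coefM big_ord_recl big_ord1 /= !coefN pow_sum_coef0 oppr0 mul0r add0r.
by rewrite pow_sum_coef1 ?AH_coef0 ?mulr1 // ltnW.
Qed.

Lemma rat_mulrn_eq0 n (x : rat) : x *+ n.+1 = 0 -> x = 0.
Proof. by move/eqP; rewrite mulrn_eq0 /= => /eqP. Qed.

(* Both sides have logarithmic derivative [- p (T^p + T^(p^2) + ...)]. *)
Lemma AH_functional N : (0 < N)%N ->
  congX N (AH N ^+ p * texp N (p%:R *: 'X)) (AH N \Po 'X^p).
Proof.
move=> N0; have p0 := ltnW p_gt1.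
have dR : logder N ((- pow_sum rat p N \Po (1 *: 'X^p)) *+ p) (AH N \Po 'X^p).
  by rewrite -{2}['X^p]scale1r; apply: logder_comp (AH_logder N).
rewrite scale1r in dR.
have dexp : logder N (theta (p%:R *: 'X)) (texp N (p%:R *: 'X)).
  by rewrite -mul_polyC; apply: texp_logder.
have dF : logder N ((- pow_sum rat p N) *+ p) (AH N ^+ p).
  by apply: logderX; apply: AH_logder.
apply: (@logder_inj _ _ ((- pow_sum rat p N \Po 'X^p) *+ p)) => //.
- exact: rat_mulrn_eq0.
- rewrite coefMn coef_comp_poly_Xn // dvdn0 div0n coefN pow_sum_coef0.
  by rewrite oppr0 mul0rn.
- rewrite coef_comp_poly_Xn // dvdn0 div0n AH_coef0 //.
  rewrite coef0M -horner_coef0 hornerE horner_coef0 AH_coef0 // expr1n mul1r.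
  case: N N0 {dR dexp dF} => // N _; rewrite /texp big_ord_recl expr0 coefD coef_sum.
  rewrite big1 => [|i _]; first by rewrite coefZ coef1 mulr1 addr0.
  by rewrite coefZ exprS coef0M coefZ coefX mulr0 mul0r mulr0.
apply: logder_congX (logderM dF dexp).
case: N N0 {dR dexp dF} => // N _.
have -> : (- pow_sum rat p N.+1) *+ p + theta (p%:R *: 'X)
          = (- (pow_sum rat p N \Po 'X^p)) *+ p.
  rewrite /theta derivZ derivX -scalerAr mulr1 scaler_nat -mulrnDl.
  by rewrite pow_sumS opprD addrAC addNr add0r.
apply: congXMn; rewrite raddfN; apply: congXN => /=.
rewrite [pow_sum _ _ N.+1]/pow_sum big_ord_recr /= -/(pow_sum _ _ N) comp_polyD.
rewrite -[X in congX _ X _]addr0; apply: congXD; first exact: congXxx.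
rewrite rmorphXn /= comp_polyX -exprM -expnS -['X^_]mul1r.
by apply/congX_sym/congX_Xn0; rewrite ltnW // ltn_expl.
Qed.
End ArtinHasse.

(** * Integrality of the Artin-Hasse series at p *)

Lemma logn_fact_lt p m : prime p -> (0 < m)%N -> (logn p m`! < m)%N.
Proof.
move=> pp m0; rewrite logn_fact // big_add1 /= big_mkord.
(* The invariant bounds partial sums of Legendre's formula. It persists because 2 (q %/ p) <= q, and
   the 1 kept by [maxn] gives the strict inequality. *)
suff inv K : (\sum_(i < K) m %/ p ^ i.+1 + maxn (m %/ p ^ K) 1 <= m)%N.
  apply: leq_trans (inv m); rewrite addnC -addn1 addnC leq_add2r.
  by rewrite leq_maxr.
elim: K => [|K IH]; first by rewrite big_ord0 expn0 divn1 add0n geq_max leqnn.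
rewrite big_ord_recr /=; apply: leq_trans IH.
rewrite -addnA leq_add2l expnSr divnMA.
set q := (m %/ p ^ K)%N.
have : (q %/ p * 2 <= q)%N.
  by apply: leq_trans (leq_trunc_div q p); rewrite leq_mul2l prime_gt1 ?orbT.
lia.
Qed.

Lemma texp_coef N (a : rat) m : (m < N)%N ->
  (texp N (a *: 'X))`_m = m`!%:R^-1 * a ^+ m.
Proof.
move=> ltmN; rewrite coef_sum (bigD1 (Ordinal ltmN)) //= big1 ?addr0.
  by rewrite exprZn !coefZ coefXn eqxx mulr1.
move=> j; rewrite -val_eqE /= => nejm.
by rewrite exprZn !coefZ coefXn eq_sym (negPf nejm) !mulr0.
Qed.

(** The coefficient is p^m / m!, and m! contains at most m - 1 factors p, so one factor p is left
    over. *)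
Lemma texp_coef_plocal p N m : prime p -> (0 < m < N)%N ->
  exists2 z, z \is a plocal p & (texp N (p%:R *: 'X))`_m = p%:R * z.
Proof.
move=> pp /andP[m0 ltmN]; rewrite texp_coef //.
exists (p%:R ^+ m.-1 / m`!%:R); last first.
  by rewrite mulrA -exprS prednK // mulrC.
set v := logn p m`!; have lev : (v <= m.-1)%N.
  by rewrite -ltnS prednK // logn_fact_lt.
have [u cu eu] : exists2 u, coprime p u & (m`! = p ^ v * u)%N.
  exists (m`!`_p^')%N; last by rewrite -p_part partnC ?fact_gt0.
  by rewrite (pnat_coprime (pi := p)) ?part_pnat // pnat_id.
have u0 : u != 0%N by apply: contraTneq (fact_gt0 m) => u0; rewrite eu u0 muln0.
have -> : p%:R ^+ m.-1 / m`!%:R = (p ^ (m.-1 - v))%:R / u%:R :> rat.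
  rewrite eu -{1}(subnK lev) exprD !natrM !natrX.
  have pv0 : p%:R ^+ v != 0 :> rat by rewrite expf_neq0 // pnatr_eq0 -lt0n prime_gt0.
  have u0' : u%:R != 0 :> rat by rewrite pnatr_eq0.
  field.
  by rewrite u0' pv0.
by apply: (@plocal_frac p (Posz (p ^ (m.-1 - v))) (Posz u)).
Qed.

Lemma Fp_poly_expp p (P : {poly 'F_p}) : prime p -> P ^+ p = P \Po 'X^p.
Proof.
move=> pp; have hp : p \in [pchar {poly 'F_p}] by rewrite pchar_poly pchar_Fp.
rewrite -(pFrobenius_autE hp) -{1}[P]coefK poly_def comp_polyE rmorph_sum /=.
apply: eq_bigr => i _; rewrite pFrobenius_autE exprZn -exprM mulnC exprM.
by congr (_ *: _); rewrite -[RHS]expf_card card_Fp.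
Qed.

(** The binomial expansion stops at first order: the terms of degree at least 2 in a carry X^(2m),
    and m > 0. *)
Lemma congX_exprDXn (R : comNzRingType) (P : {poly R}) a m n : (0 < m)%N ->
  congX m.+1 ((P + a *: 'X^m) ^+ n) (P ^+ n + (a *+ n) *: (P ^+ n.-1 * 'X^m)).
Proof.
move=> m0; case: n => [|n]; first by rewrite !expr0 mulr0n scale0r addr0; apply: congXxx.
elim: n => [|n IH] /=; first by rewrite !expr1 expr0 mul1r mulr1n; apply: congXxx.
rewrite exprS; apply: congX_trans (congXM (congXxx _ _) IH) _.
exists ((a * (a *+ n.+1)) *: (P ^+ n * 'X^(m.-1))).
have eY : 'X^(m.-1) * 'X^(m.+1) = 'X^m * 'X^m :> {poly R}.
  by rewrite -!exprD addnS -addSn prednK.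
rewrite -scalerAl -mulrA eY -!mul_polyC !polyCM !polyCMn.
rewrite -[_ *+ n.+1]mulr_natr -[_ *+ n.+2]mulr_natr -[n.+2%:R]natr1 !exprS /=.
by ring.
Qed.

Lemma plocal_insubdK p (x : rat) :
  x \is a plocal p -> val (insubd (0 : Zp_loc p) x) = x.
Proof. by move=> xZ; rewrite insubdK. Qed.

Lemma polyOver_plocal_lift p (P : {poly rat}) :
  P \is a polyOver (plocal p) -> exists P' : {poly Zp_loc p}, P = map_poly (@Zp_val p) P'.
Proof.
move=> /polyOverP PP; exists (\poly_(i < size P) insubd (0 : Zp_loc p) P`_i).
apply/polyP=> i; rewrite coef_map coef_poly; case: ltnP => [_|lesi].
  by symmetry; apply: plocal_insubdK; apply: PP.
by rewrite nth_default.
Qed.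

Lemma AH_coef_pred p m : (0 < m)%N ->
  AH p m.+1 = AH p m + artin_hasse_coef p m *: 'X^m.
Proof. by move=> m0; rewrite /AH !poly_def big_ord_recr. Qed.

(** Dwork's argument: in the coefficient of T^m of F(T)^p exp(pT) = F(T^p), the unknown a occurs
    only as p a. The other terms are integral by induction and agree modulo p, since F^p is
    congruent to F(T^p) and exp(pT) to 1. Hence p a lies in p Z_(p). *)
Lemma artin_hasse_plocal p m : prime p -> artin_hasse_coef p m \is a plocal p.
Proof.
move=> pp; have p1 := prime_gt1 pp; have p0 := prime_gt0 pp.
elim/ltn_ind: m => m IH.
have [->|m0] := posnP m.
  have := AH_coef0 p (ltn0Sn 0); rewrite coef_poly /= => ->; exact: rpred1.
set a := artin_hasse_coef p m; set F := AH p m.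
have FZ : F \is a polyOver (plocal p).
  apply/polyOverP=> i; rewrite coef_poly; case: ltnP => [/IH//|_]; exact: rpred0.
have FpZ i : (F ^+ p)`_i \is a plocal p.
  by apply/polyOverP; apply: rpredX.
have eF : AH p m.+1 = F + a *: 'X^m by rewrite AH_coef_pred.
have cF i : (i < m)%N -> (AH p m.+1 ^+ p)`_i = (F ^+ p)`_i.
  move: i; apply/congXP; apply: congXX; rewrite eF -mul_polyC.
  by exists a%:P.
have cm : (AH p m.+1 ^+ p)`_m = (F ^+ p)`_m + p%:R * a.
  have /congXP/(_ m (ltnSn m)) := congX_exprDXn F a p m0; rewrite -eF => ->.
  rewrite coefD coefZ coefMXn ltnn subnn.
  rewrite -[(F ^+ p.-1)`_0]horner_coef0 hornerE horner_coef0 AH_coef0 //.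
  by rewrite expr1n mulr1 mulr_natl.
have [y yZ ey] : exists2 y, y \is a plocal p &
    (F \Po 'X^p)`_m - (F ^+ p)`_m = p%:R * y.
  have [F' ->] := polyOver_plocal_lift FZ.
  have hp := pchar_Fp pp.
  (* Modulo p, raising to the power p is the substitution of T^p, the coefficients being in F_p. *)
  have /Zp_red_eq0[y ey] : Zp_red hp ((F' \Po 'X^p) - F' ^+ p)`_m = 0.
    rewrite -coef_map rmorphB rmorphXn /= map_comp_poly map_polyXn.
    by rewrite (Fp_poly_expp (map_poly (Zp_red hp) F') pp) subrr coef0.
  exists (val y); first exact: valP.
  have e1 : map_poly (@Zp_val p) ((F' \Po 'X^p) - F' ^+ p)
            = (map_poly (@Zp_val p) F' \Po 'X^p) - map_poly (@Zp_val p) F' ^+ p.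
    by rewrite rmorphB rmorphXn /= map_comp_poly map_polyXn.
  have -> : p%:R * val y = Zp_val (p%:R * y) by rewrite (rmorphM (@Zp_val p)) rmorph_nat.
  by rewrite -coefB -e1 coef_map ey.
have /congXP/(_ m (ltnSn m)) := AH_functional p1 (ltn0Sn m).
rewrite coefM big_ord_recr /= subnn cm.
have -> : (texp m.+1 (p%:R *: 'X))`_0 = 1 by rewrite texp_coef // expr0 mulr1 invr1.
(* Only the coefficient of index m / p < m is read, so a does not enter on this side. *)
have -> : (AH p m.+1 \Po 'X^p)`_m = (F \Po 'X^p)`_m.
  rewrite !coef_comp_poly_Xn // !coef_poly; case: ifP => // _.
  by rewrite ltn_Pdiv // ltnS leq_div.
have [z zZ ->] : exists2 z, z \is a plocal p &
   \sum_(i < m) (AH p m.+1 ^+ p)`_i * (texp m.+1 (p%:R *: 'X))`_(m - i) = p%:R * z.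
  apply: (big_ind (fun x => exists2 z, z \is a plocal p & x = p%:R * z)).
  - by exists 0; rewrite ?rpred0 ?mulr0.
  - move=> _ _ [x xZ ->] [w wZ ->]; exists (x + w); rewrite ?mulrDr //.
    exact: rpredD.
  - move=> i _; rewrite cF //.
    have [|z zZ ->] := @texp_coef_plocal p m.+1 (m - i) pp.
      by rewrite subn_gt0 ltn_ord ltnS leq_subr.
    by exists ((F ^+ p)`_i * z); rewrite ?rpredM // mulrCA.
rewrite mulr1 => e; suff -> : a = y - z by rewrite rpredB.
have pn0 : p%:R != 0 :> rat by rewrite pnatr_eq0 -lt0n.
by apply: (mulfI pn0); rewrite mulrBr -ey -e; ring.
Qed.

(** * Products of the series F(z_i T^(p^i)) and ghost components *)

Definition witt_prod (R : comNzRingType) (p n : nat) (A : {poly R}) (z : nat -> R) :=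
  \prod_(i < n) (A \Po (z i *: 'X^(p ^ i))).

Lemma eq_witt_prod (R : comNzRingType) (p n : nat) (A : {poly R}) (z z' : nat -> R) :
  (forall i, (i < n)%N -> z i = z' i) -> witt_prod p n A z = witt_prod p n A z'.
Proof. by move=> e; apply: eq_bigr => i _; rewrite e. Qed.

Lemma map_witt_prod (R S : comNzRingType) (f : {rmorphism R -> S}) p n A z :
  map_poly f (witt_prod p n A z) = witt_prod p n (map_poly f A) (f \o z).
Proof.
rewrite rmorph_prod; apply: eq_bigr => i _ /=.
by rewrite map_comp_poly map_polyZ map_polyXn.
Qed.

Lemma witt_prod_coef0 (R : comNzRingType) p n (A : {poly R}) z :
  (0 < p)%N -> A`_0 = 1 -> (witt_prod p n A z)`_0 = 1.
Proof.
move=> p0 A0; rewrite -horner_coef0 horner_prod big1 // => i _.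
rewrite horner_comp hornerZ hornerXn expr0n.
by rewrite gtn_eqF ?expn_gt0 ?p0 // mulr0 horner_coef0.
Qed.

(** Monomials are grouped by m = i + j; those with i + j >= n vanish modulo X^(p^n). *)
Lemma ghost_sum (R : comNzRingType) p n N (z : nat -> R) : (1 < p)%N -> (n <= N)%N ->
  congX (p ^ n) (\sum_(i < n) \sum_(j < N) (p ^ i)%:R *: (z i *: 'X^(p ^ i)) ^+ (p ^ j))
    (\sum_(m < n) ghost p m z *: 'X^(p ^ m)).
Proof.
move=> p1 lenN.
pose g i m := ((p ^ i)%:R * z i ^+ (p ^ (m - i))) *: 'X^(p ^ m) : {poly R}.
have -> : \sum_(m < n) ghost p m z *: 'X^(p ^ m) =
          \sum_(i < n) \sum_(m < n | (i <= m)%N) g i m.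
  rewrite (exchange_big_dep predT) //=; apply: eq_bigr => m _.
  by rewrite scaler_suml (big_ord_widen n (g^~ m)).
apply: congX_sum => i _.
have -> : \sum_(m < n | (i <= m)%N) g i m = \sum_(j < n - i) g i (j + i)%N.
  have <- : \sum_(i <= m < n) g i m = \sum_(j < n - i) g i (j + i)%N.
    by rewrite -{1}[nat_of_ord i]add0n big_addn big_mkord.
  by rewrite big_geq_mkord.
have -> : \sum_(j < N) (p ^ i)%:R *: (z i *: 'X^(p ^ i)) ^+ (p ^ j)
          = \sum_(j < N) g i (j + i)%N.
  apply: eq_bigr => j _; rewrite /g addnK exprZn scalerA -exprM -expnD.
  by rewrite addnC.
apply: (congX_sum_tail (f := fun j => g i (j + i)%N)) => [|j lej].
  by rewrite (leq_trans (leq_subr _ _)).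
rewrite /g -mul_polyC; apply: congX_Xn0; rewrite leq_exp2l //.
by rewrite addnC -leq_subLR.
Qed.

Section RationalAlgebra.
Variables (R : comNzRingType) (f : {rmorphism rat -> R}) (p : nat).
Hypothesis p_gt1 : (1 < p)%N.

Lemma ratalg_mulrn_eq0 n (x : R) : x *+ n.+1 = 0 -> x = 0.
Proof.
move=> xn0; rewrite -[x]mul1r -(rmorph1 f) -(@mulVf _ n.+1%:R) ?pnatr_eq0 //.
by rewrite rmorphM rmorph_nat -mulrA mulr_natl xn0 mulr0.
Qed.

Lemma AH_comp_logder N c q : (0 < q)%N ->
  logder N (- \sum_(j < N) q%:R *: (c *: 'X^q) ^+ (p ^ j))
    (map_poly f (AH p N) \Po (c *: 'X^q)).
Proof.
move=> q0; have dA : logder N (- pow_sum R p N) (map_poly f (AH p N)).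
  have [D e] := AH_logder p_gt1 N; exists (map_poly f D).
  have -> : theta (map_poly f (AH p N)) = map_poly f (theta (AH p N)).
    by rewrite /theta rmorphM /= deriv_map map_polyX.
  rewrite e.
  rewrite rmorphD !rmorphM rmorphN rmorph_sum /= map_polyXn; congr (- _ * _ + _).
  by apply: eq_bigr => j _; rewrite map_polyXn.
have := logder_comp c q0 dA; congr (logder _ _ _).
rewrite raddfN /= mulNrn raddf_sum /= -sumrMnl; congr (- _).
by apply: eq_bigr => j _; rewrite rmorphXn /= comp_polyX scaler_nat.
Qed.

Lemma AH_prod_logder n N z : (p ^ n <= N)%N ->
  logder (p ^ n) (- \sum_(m < n) ghost p m z *: 'X^(p ^ m))
    (witt_prod p n (map_poly f (AH p N)) z).
Proof.
move=> lepN; have lenN : (n <= N)%N by rewrite (leq_trans _ lepN) // ltnW // ltn_expl.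
apply: logder_congX (congXN (ghost_sum z p_gt1 lenN)) _.
apply: logder_leq lepN _; rewrite -sumrN; apply: logder_prod => i _.
by apply: AH_comp_logder; rewrite expn_gt0 ltnW.
Qed.

(** Both sides have constant term 1 and, by the equality of ghost components, the same logarithmic
    derivative; a Q-algebra has no torsion, so [logder_inj] applies. *)
Lemma AH_prod_ghost n N x y S : (p ^ n <= N)%N ->
  (forall m, (m < n)%N -> ghost p m S = ghost p m x + ghost p m y) ->
  congX (p ^ n) (witt_prod p n (map_poly f (AH p N)) S)
   (witt_prod p n (map_poly f (AH p N)) x * witt_prod p n (map_poly f (AH p N)) y).
Proof.
move=> lepN eS; have p0 := ltnW p_gt1.
have N0 : (0 < N)%N by apply: leq_trans lepN; rewrite expn_gt0 p0.
have A0 : (map_poly f (AH p N))`_0 = 1 by rewrite coef_map (AH_coef0 p N0); exact: rmorph1.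
apply: (logder_inj ratalg_mulrn_eq0 _ _ (AH_prod_logder S lepN)); last first.
- apply: logder_congX (logderM (AH_prod_logder x lepN) (AH_prod_logder y lepN)).
  rewrite -opprD -big_split /=; apply: congXN; apply: congX_sum => m _.
  by rewrite eS // scalerDl; apply: congXxx.
- by rewrite coef0M !witt_prod_coef0 ?mulr1.
rewrite coefN coef_sum big1 ?oppr0 // => m _.
by rewrite coefZ coefXn ltn_eqF ?mulr0 // expn_gt0 p0.
Qed.

End RationalAlgebra.

Lemma congX_comp_XnB1 (R : comNzRingType) (A : {poly R}) (z : R) q :
    A`_0 = 1 -> A`_1 = -1 -> (0 < q)%N ->
  congX q.+1 (A \Po (z *: 'X^q)) (1 - z *: 'X^q).
Proof.
move=> A0 A1 q0.
have [D ->] : congX 2 A (1 - 'X).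
  by apply/congXP=> -[|[|//]] _; rewrite coefB coef1 coefX ?subr0 ?sub0r.
exists ((D \Po (z *: 'X^q)) * (z ^+ 2 *: 'X^(q.-1))).
rewrite comp_polyD comp_polyM comp_polyB rmorph1 rmorphXn /= !comp_polyX.
congr (_ + _); rewrite -mulrA; congr (_ * _).
rewrite exprZn -exprM -scalerAl -exprD; congr (_ *: 'X^_); lia.
Qed.

(** To this precision the new factor is 1 - z_n T^(p^n), and it multiplies a product with constant
    term 1. *)
Lemma witt_prodS (R : comNzRingType) p n (A : {poly R}) z :
    (0 < p)%N -> A`_0 = 1 -> A`_1 = -1 ->
  congX (p ^ n).+1 (witt_prod p n.+1 A z) (witt_prod p n A z - z n *: 'X^(p ^ n)).
Proof.
move=> p0 A0 A1; rewrite {1}/witt_prod big_ord_recr /= -/(witt_prod p n A z).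
have q0 : (0 < p ^ n)%N by rewrite expn_gt0 p0.
apply: congX_trans (congXM (congXxx _ _) (congX_comp_XnB1 (z n) A0 A1 q0)) _.
rewrite mulrBr mulr1; apply: congXD; first exact: congXxx.
apply: congXN; rewrite -scalerAr; apply: congXZ; apply/congXP=> i; rewrite ltnS.
rewrite leq_eqVlt coefMXn coefXn => /orP[/eqP ->|lti]; last by rewrite lti ltn_eqF.
by rewrite ltnn subnn eqxx witt_prod_coef0.
Qed.

Lemma witt_prod_polyOver (R : comNzRingType) (Z : subringClosed R) p n
    (A : {poly R}) z :
  A \is a polyOver Z -> (forall i, (i < n)%N -> z i \in Z) ->
  witt_prod p n A z \is a polyOver Z.
Proof.
move=> AZ zZ; apply: rpred_prod => i _; apply: polyOver_comp => //.
by apply: polyOverZ; rewrite ?zZ // rpredX ?polyOverX.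
Qed.

(** * Integrality of the Witt addition polynomials *)

Definition mplocal_pred (p n : nat) (P : {mpoly rat[n]}) : bool :=
  P \is a mpolyOver n (plocal p).
Arguments mplocal_pred p n P /.
Definition mplocal (p n : nat) := [qualify a P : {mpoly rat[n]} | mplocal_pred p P].

Lemma mplocalP p n (P : {mpoly rat[n]}) :
  reflect (forall m, P@_m \is a plocal p) (P \is a mplocal p n).
Proof. exact: mpolyOverP. Qed.

Fact mplocal_subring_closed p n : subring_closed (mplocal p n).
Proof.
split=> [|P Q /mplocalP PZ /mplocalP QZ|P Q /mplocalP PZ /mplocalP QZ];
  apply/mplocalP => m.
- by rewrite mcoeff1; case: (_ == _); [exact: rpred1 | exact: rpred0].
- by rewrite mcoeffB rpredB.
by rewrite mcoeffM; apply: rpred_sum => i _; apply: rpredM.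
Qed.

HB.instance Definition _ p n :=
  GRing.isSubringClosed.Build {mpoly rat[n]} (@mplocal_pred p n)
    (@mplocal_subring_closed p n).

Lemma mplocalX p n i : 'X_i \is a mplocal p n.
Proof. exact: mpolyOverX. Qed.

Section WittSum.
Variables (p n : nat).
Hypothesis pp : prime p.
Let K := {mpoly rat[n + n]}.
Let S i : K := (witt_sum p n n)`_i.
Let f : {rmorphism rat -> K} := @mpolyC (n + n) rat.

Lemma size_witt_sum m : size (witt_sum p n m) = m.
Proof. by elim: m => //= m IH; rewrite size_rcons IH. Qed.

Lemma witt_sum_nth m i : (i < m)%N -> (m <= n)%N -> (witt_sum p n m)`_i = S i.
Proof.
move=> ltim; rewrite /S.
suff H N : (m <= N)%N -> (witt_sum p n m)`_i = (witt_sum p n N)`_i by apply: H.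
elim: N => [|N IH]; first by case: m ltim.
rewrite leq_eqVlt => /orP[/eqP -> //|]; rewrite ltnS => lemN.
by rewrite /= nth_rcons size_witt_sum (leq_trans ltim lemN) -IH.
Qed.

(** The recursion defining S_m is this equation solved for its last term p^m S_m; division by p^m is
    possible over Q. *)
Lemma witt_sum_ghost m : (m < n)%N ->
  ghost p m S = ghost p m (witt_x n) + ghost p m (witt_y n).
Proof.
move=> ltmn; rewrite {1}/ghost big_ord_recr /= subnn expn0 expr1.
have -> : S m = (witt_sum p n m.+1)`_m by rewrite witt_sum_nth.
rewrite /= nth_rcons size_witt_sum ltnn eqxx mulr_natl -scaler_nat scalerA.
rewrite mulfV ?pnatr_eq0 -?lt0n ?expn_gt0 ?prime_gt0 // scale1r addrC.
have -> : \sum_(i < m) (p ^ i)%:R * S i ^+ (p ^ (m - i))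
          = \sum_(i < m) (p ^ i)%:R * (witt_sum p n m)`_i ^+ (p ^ (m - i)).
  by apply: eq_bigr => i _; rewrite witt_sum_nth // ltnW.
by rewrite subrK.
Qed.

Lemma AH_witt_sum m N : (m <= n)%N -> (p ^ m <= N)%N ->
  congX (p ^ m) (witt_prod p m (map_poly f (AH p N)) S)
   (witt_prod p m (map_poly f (AH p N)) (witt_x n) *
    witt_prod p m (map_poly f (AH p N)) (witt_y n)).
Proof.
move=> lemn lepN; apply: AH_prod_ghost => //; first exact: prime_gt1.
by move=> i ltim; apply: witt_sum_ghost; apply: leq_trans lemn.
Qed.

Lemma witt_x_int i : witt_x n i \is a mplocal p (n + n).
Proof. by rewrite /witt_x; case: insub => [j|] /=; [exact: mplocalX | exact: rpred0]. Qed.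

Lemma witt_y_int i : witt_y n i \is a mplocal p (n + n).
Proof. by rewrite /witt_y; case: insub => [j|] /=; [exact: mplocalX | exact: rpred0]. Qed.

Lemma witt_prod_int m N z j :
  (forall i, (i < m)%N -> z i \is a mplocal p (n + n)) ->
  (witt_prod p m (map_poly f (AH p N)) z)`_j \is a mplocal p (n + n).
Proof.
move=> zZ; apply/polyOverP; apply: witt_prod_polyOver => //.
apply/polyOverP=> i; rewrite coef_map coef_poly /=; apply/mplocalP => l.
rewrite mcoeffC; apply: rpredM; last by case: eqP; rewrite ?rpred0 ?rpred1.
by case: ifP => _; [exact: artin_hasse_plocal | exact: rpred0].
Qed.

(* The coefficient of [T^(p^m)] expresses [S_m] through [S_0, ..., S_(m-1)]   *)
(* and the p-integral coefficients of the Artin-Hasse series.                 *)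
Lemma witt_sum_int m : (m < n)%N -> S m \is a mplocal p (n + n).
Proof.
elim/ltn_ind: m => m IH ltmn; have p1 := prime_gt1 pp; have p0 := prime_gt0 pp.
pose N := (p ^ m.+1)%N; pose A := map_poly f (AH p N).
have N1 : (1 < N)%N by rewrite -{1}(expn0 p) ltn_exp2l.
have A0 : A`_0 = 1 by rewrite coef_map (AH_coef0 p (ltnW N1)); exact: rmorph1.
have A1 : A`_1 = -1.
  by rewrite coef_map (AH_coef1 p1 N1); exact: rmorphN1.
have ltp : (p ^ m < p ^ m.+1)%N by rewrite ltn_exp2l.
have /congXP/(_ _ ltp) := AH_witt_sum ltmn (leqnn _).
have /congXP/(_ _ (ltnSn _)) -> := witt_prodS m S p0 A0 A1.
rewrite coefB coefZ coefXn eqxx mulr1 => /eqP; rewrite subr_eq => /eqP e.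
have -> : S m = (witt_prod p m A S)`_(p ^ m) -
   (witt_prod p m.+1 A (witt_x n) * witt_prod p m.+1 A (witt_y n))`_(p ^ m).
  by rewrite e addrC addKr.
apply: rpredB; first by apply: witt_prod_int => i ltim; apply/IH/(ltn_trans ltim).
rewrite coefM; apply: rpred_sum => i _; apply: rpredM; apply: witt_prod_int => j _.
  exact: witt_x_int.
exact: witt_y_int.
Qed.

End WittSum.

(** * Transport of the Artin-Hasse identities from Q to k *)

Lemma mpolyOver_plocal_lift p n (P : {mpoly rat[n]}) :
  P \is a mplocal p n ->
  exists P' : {mpoly Zp_loc p[n]}, P = map_mpoly (@Zp_val p) P'.
Proof.
move=> /mplocalP PZ.
exists (\sum_(m <- msupp P) insubd (0 : Zp_loc p) P@_m *: 'X_[m]).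
rewrite {1}[P]mpolyE rmorph_sum; apply: eq_bigr => m _.
rewrite [RHS]map_mpolyZ map_mpolyX; congr (_ *: _).
by symmetry; apply/plocal_insubdK/PZ.
Qed.

(** [witt_add] applies the non-additive [red_rat] coefficientwise. On polynomials coming from Z_(p)
    this is a ring morphism, the support being unchanged under the injection into Q. *)
Lemma map_mpoly_red p (k : fieldType) (hp : p \in [pchar k]) n (P : {mpoly Zp_loc p[n]}) :
  map_mpoly (red_rat k) (map_mpoly (@Zp_val p) P) = map_mpoly (Zp_red hp) P.
Proof.
have injv : injective (@Zp_val p) by exact: val_inj.
rewrite /map_mpoly /mmap (perm_big _ (msupp_map_mpoly P injv)) /=.
by apply: eq_bigr => m _; rewrite mcoeff_map_mpoly.
Qed.

Lemma map_mpoly_inj n (R S : nzRingType) (f : {rmorphism R -> S}) :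
  injective f -> injective (map_mpoly f : {mpoly R[n]} -> {mpoly S[n]}).
Proof.
move=> injf P Q e; apply/mpolyP=> m; apply: injf.
by rewrite -!mcoeff_map_mpoly e.
Qed.

Lemma map_congX (R S : comNzRingType) (f : {rmorphism R -> S}) N P Q :
  congX N P Q -> congX N (map_poly f P) (map_poly f Q).
Proof. by move=> /congXP e; apply/congXP=> i ltiN; rewrite !coef_map e. Qed.

Lemma map_congX_inj (R S : comNzRingType) (f : {rmorphism R -> S}) N P Q :
  injective f -> congX N (map_poly f P) (map_poly f Q) -> congX N P Q.
Proof.
move=> injf /congXP e; apply/congXP=> i ltiN; apply: injf.
by rewrite -!coef_map e.
Qed.

(** Extension by zero turns a row into a sequence indexed by [nat], the form expected by
    [witt_prod]. *)
Definition row_fun (k : fieldType) n (t : 'rV[k]_n) (i : nat) : k :=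
  oapp (fun i' : 'I_n => t 0 i') 0 (insub i).

Lemma row_funE (k : fieldType) n (t : 'rV[k]_n) (i : 'I_n) : row_fun t i = t 0 i.
Proof. by rewrite /row_fun valK. Qed.

Section ReducedArtinHasse.
Variables (k : fieldType) (p : nat).
Hypothesis hp : p \in [pchar k].
Let pp : prime p := pcharf_prime hp.

Definition AHk N : {poly k} := \poly_(m < N) red_rat k (artin_hasse_coef p m).

Lemma AHk_lift N : exists2 A : {poly Zp_loc p},
  AH p N = map_poly (@Zp_val p) A & AHk N = map_poly (Zp_red hp) A.
Proof.
have /polyOver_plocal_lift[A eA] : AH p N \is a polyOver (plocal p).
  apply/polyOverP=> i; rewrite coef_poly.
  by case: ifP => _; [exact: artin_hasse_plocal | exact: rpred0].
exists A => //; apply/polyP=> i; rewrite coef_map coef_poly /=.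
have : (AH p N)`_i = Zp_val A`_i by rewrite eA coef_map.
rewrite coef_poly; case: ifP => _ => e; first by rewrite /Zp_red /= -e.
have -> : A`_i = 0 by apply: val_inj; rewrite -[LHS]e.
by rewrite raddf0.
Qed.

Lemma red_rat1 : red_rat k 1 = 1. Proof. by rewrite /red_rat divr1. Qed.
Lemma red_ratN1 : red_rat k (-1) = -1. Proof. by rewrite /red_rat divr1. Qed.

Lemma AHk_coef N i : (i < N)%N -> (AHk N)`_i = red_rat k (AH p N)`_i.
Proof. by move=> ltiN; rewrite !coef_poly ltiN. Qed.

Lemma AHk_coef0 N : (0 < N)%N -> (AHk N)`_0 = 1.
Proof. by move=> N0; rewrite AHk_coef // AH_coef0 // red_rat1. Qed.

Lemma AHk_coef1 N : (1 < N)%N -> (AHk N)`_1 = -1.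
Proof. by move=> N1; rewrite AHk_coef // AH_coef1 ?red_ratN1 // prime_gt1. Qed.

(** All ingredients of the identity [AH_witt_sum] over Q[x, y] come from Z_(p)[x, y], which embeds
    there. The identity therefore descends to Z_(p)[x, y] and can be specialised to k. *)
Lemma AHk_witt_add n N (s t : 'rV[k]_n) : (p ^ n <= N)%N ->
  congX (p ^ n) (witt_prod p n (AHk N) (row_fun (witt_add p s t)))
    (witt_prod p n (AHk N) (row_fun s) * witt_prod p n (AHk N) (row_fun t)).
Proof.
move=> lepN; have [A eA ->] := AHk_lift N.
pose v i : k := row_mx s t 0 i.
(* [rho] reduces coefficients modulo p and sends the variables x, y to the entries of s, t. *)
pose rho : {rmorphism {mpoly Zp_loc p[n + n]} -> k} :=
  meval v \o map_mpoly (Zp_red hp).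
have [S eS] : exists S : nat -> {mpoly Zp_loc p[n + n]}, forall i, (i < n)%N ->
    (witt_sum p n n)`_i = map_mpoly (@Zp_val p) (S i).
  have ex (i : 'I_n) : exists P : {mpoly Zp_loc p[n + n]},
      (witt_sum p n n)`_i = map_mpoly (@Zp_val p) P.
    by apply/mpolyOver_plocal_lift/witt_sum_int.
  have [S eS] := fin_all_exists ex.
  exists (fun i => oapp S 0 (insub i)) => i ltin.
  by rewrite insubT /= -eS.
pose x i : {mpoly Zp_loc p[n + n]} := oapp (fun i' : 'I_n => 'X_(lshift n i')) 0 (insub i).
pose y i : {mpoly Zp_loc p[n + n]} := oapp (fun i' : 'I_n => 'X_(rshift n i')) 0 (insub i).
have ex i : witt_x n i = map_mpoly (@Zp_val p) (x i).
  by rewrite /witt_x /x; case: insub => [j|] /=; rewrite ?map_mpolyX ?raddf0.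
have ey i : witt_y n i = map_mpoly (@Zp_val p) (y i).
  by rewrite /witt_y /y; case: insub => [j|] /=; rewrite ?map_mpolyX ?raddf0.
pose fZ : {rmorphism Zp_loc p -> {mpoly Zp_loc p[n + n]}} := @mpolyC (n + n) (Zp_loc p).
pose B := map_poly fZ A.
have e : congX (p ^ n) (witt_prod p n B S) (witt_prod p n B x * witt_prod p n B y).
  have injv : injective (map_mpoly (@Zp_val p) : {mpoly Zp_loc p[n + n]} -> _).
    by apply: map_mpoly_inj; exact: val_inj.
  apply: (map_congX_inj injv).
  have eB : map_poly (map_mpoly (@Zp_val p)) B = map_poly (@mpolyC (n + n) rat) (AH p N).
    rewrite eA -!map_poly_comp; apply: eq_map_poly => c /=.
    by rewrite map_mpolyC.
  rewrite rmorphM /= !map_witt_prod eB.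
  have -> C : witt_prod p n C (map_mpoly (@Zp_val p) \o S)
      = witt_prod p n C (nth 0 (witt_sum p n n)).
    by apply: eq_witt_prod => i ltin; rewrite /= -eS.
  have -> C : witt_prod p n C (map_mpoly (@Zp_val p) \o x) = witt_prod p n C (witt_x n).
    by apply: eq_witt_prod => i _; rewrite /= ex.
  have -> C : witt_prod p n C (map_mpoly (@Zp_val p) \o y) = witt_prod p n C (witt_y n).
    by apply: eq_witt_prod => i _; rewrite /= ey.
  exact: AH_witt_sum.
have eB : map_poly rho B = map_poly (Zp_red hp) A.
  rewrite -map_poly_comp; apply: eq_map_poly => c /=.
  by rewrite map_mpolyC mevalC.
have := map_congX rho e; rewrite rmorphM /= !map_witt_prod eB.
congr (congX _ _ (_ * _)); apply: eq_witt_prod => i ltin.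
- rewrite /row_fun insubT /= mxE -(map_mpoly_red hp) -eS //=.
- rewrite /row_fun /= /x insubT /= map_mpolyX mevalXU /v row_mxEl.
  by congr (s _ _).
rewrite /row_fun /= /y insubT /= map_mpolyX mevalXU /v row_mxEr.
by congr (t _ _).
Qed.

(** For p odd all exponents p^j in log F are odd, so F(-T) F(T) has logarithmic derivative 0. This
    is shown over Q, reflected into Z_(p), then reduced. *)
Lemma AHk_oppr N : p != 2%N -> (0 < N)%N ->
  congX N ((AHk N \Po - 'X) * AHk N) 1.
Proof.
move=> p2 N0; have [A eA ->] := AHk_lift N.
have p1 := prime_gt1 pp.
have oddp : odd p by case/even_prime: pp => [p2'|//]; rewrite p2' eqxx in p2.
have eN (R : comNzRingType) : - 'X = -1 *: 'X^1 :> {poly R} by rewrite scaleN1r.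
suff e : congX N ((AH p N \Po - 'X) * AH p N) 1.
  have injv : injective (@Zp_val p) by exact: val_inj.
  have /map_congX_inj : congX N (map_poly (@Zp_val p) ((A \Po - 'X) * A)) (map_poly (@Zp_val p) 1).
    by rewrite rmorphM rmorph1 /= map_comp_poly rmorphN /= map_polyX -eA.
  move=> /(_ injv)/(map_congX (Zp_red hp)).
  by rewrite rmorphM rmorph1 /= map_comp_poly rmorphN /= map_polyX.
have d1 : logder N (pow_sum rat p N) (AH p N \Po - 'X).
  have := @AH_comp_logder rat idfun p p1 N (-1) 1 isT.
  rewrite map_poly_id // -eN; congr (logder _ _ _).
  rewrite -sumrN; apply: eq_bigr => j _.
  rewrite scale1r exprNn -signr_odd oddX oddp orbT expr1.
  by rewrite mulN1r opprK.
apply: (logder_inj (@rat_mulrn_eq0) (H := 0)); rewrite ?coef0 //.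
- rewrite coef0M -horner_coef0 horner_comp hornerN hornerX oppr0 horner_coef0.
  by rewrite AH_coef0 // mulr1 coef1.
- by rewrite -(subrr (pow_sum rat p N)); apply: logderM d1 (AH_logder p1 N).
exact: logder1.
Qed.

End ReducedArtinHasse.

(** * Polynomial functions and their field of definition *)

Section PolynomialFunctions.
Variables (l k : fieldType) (iota : {rmorphism l -> k}) (n : nat).
Implicit Types F G : 'rV[k]_n -> k.

(** The morphism [iota] records where the coefficients live: a subfield embedding gives definedness
    over l, and [idfun] gives regularity over k. *)
Definition polyfun F :=
  exists P : {mpoly l[n]}, forall x, F x = (map_mpoly iota P).@[fun j => x 0 j].

Lemma eq_polyfun F G : F =1 G -> polyfun F -> polyfun G.
Proof. by move=> e [P eP]; exists P => x; rewrite -e. Qed.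

Lemma polyfunC c : polyfun (fun=> iota c).
Proof. by exists c%:MP => x; rewrite map_mpolyC mevalC. Qed.

Lemma polyfun0 : polyfun (fun=> 0).
Proof. by apply: eq_polyfun (polyfunC 0) => x; rewrite rmorph0. Qed.

Lemma polyfun_coord j : polyfun (fun x => x 0 j).
Proof. by exists 'X_j => x; rewrite map_mpolyX mevalXU. Qed.

Lemma polyfunD F G : polyfun F -> polyfun G -> polyfun (fun x => F x + G x).
Proof. by move=> [P eP] [Q eQ]; exists (P + Q) => x; rewrite rmorphD mevalD eP eQ. Qed.

Lemma polyfunN F : polyfun F -> polyfun (fun x => - F x).
Proof. by move=> [P eP]; exists (- P) => x; rewrite rmorphN mevalN eP. Qed.

Lemma polyfunM F G : polyfun F -> polyfun G -> polyfun (fun x => F x * G x).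
Proof. by move=> [P eP] [Q eQ]; exists (P * Q) => x; rewrite rmorphM mevalM eP eQ. Qed.

Lemma polyfun_sum (I : Type) (r : seq I) (F : I -> 'rV[k]_n -> k) :
  (forall i, polyfun (F i)) -> polyfun (fun x => \sum_(i <- r) F i x).
Proof.
move=> pF; elim: r => [|i r IH].
  by apply: eq_polyfun polyfun0 => x; rewrite big_nil.
by apply: eq_polyfun (polyfunD (pF i) IH) => x; rewrite big_cons.
Qed.

Definition polymx a b (F : 'rV[k]_n -> 'M[k]_(a, b)) :=
  forall i j, polyfun (fun x => F x i j).

Lemma polymx_map a b (A : 'M[l]_(a, b)) : polymx (fun=> map_mx iota A).
Proof. by move=> i j; apply: eq_polyfun (polyfunC (A i j)) => x; rewrite mxE. Qed.

Lemma polymxD a b (F G : 'rV[k]_n -> 'M[k]_(a, b)) :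
  polymx F -> polymx G -> polymx (fun x => F x + G x).
Proof.
by move=> pF pG i j; apply: eq_polyfun (polyfunD (pF i j) (pG i j)) => x; rewrite mxE.
Qed.

Lemma polymxZ a b c (F : 'rV[k]_n -> 'M[k]_(a, b)) :
  polyfun c -> polymx F -> polymx (fun x => c x *: F x).
Proof.
by move=> pc pF i j; apply: eq_polyfun (polyfunM pc (pF i j)) => x; rewrite mxE.
Qed.

Lemma polymxM a b c (F : 'rV[k]_n -> 'M[k]_(a, b)) (G : 'rV[k]_n -> 'M[k]_(b, c)) :
  polymx F -> polymx G -> polymx (fun x => F x *m G x).
Proof.
move=> pF pG i j; apply: (@eq_polyfun (fun x => \sum_h F x i h * G x h j)) => [x|].
  by rewrite mxE.
by apply: polyfun_sum => h; apply: polyfunM.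
Qed.

Lemma polymx1 a : polymx (fun=> 1%:M : 'M[k]_a).
Proof. by rewrite -(map_mx1 iota); apply: polymx_map. Qed.

Lemma polymx_sum a b (I : Type) (r : seq I) (F : I -> 'rV[k]_n -> 'M[k]_(a, b)) :
  (forall i, polymx (F i)) -> polymx (fun x => \sum_(i <- r) F i x).
Proof.
move=> pF i j; apply: (@eq_polyfun (fun x => \sum_(h <- r) F h x i j)) => [x|].
  by rewrite summxE.
by apply: polyfun_sum => h; apply: pF.
Qed.

Lemma polymxX a (F : 'rV[k]_n -> 'M[k]_a) m : polymx F -> polymx (fun x => F x ^+ m).
Proof.
move=> pF; elim: m => [|m IH i j]; first exact: polymx1.
by apply: eq_polyfun (polymxM pF IH i j) => x; rewrite exprS.
Qed.

Lemma polymx_prod a (I : Type) (r : seq I) (F : I -> 'rV[k]_n -> 'M[k]_a) :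
  (forall i, polymx (F i)) -> polymx (fun x => \prod_(i <- r) F i x).
Proof.
move=> pF; elim: r => [|h r IH] i j.
  by apply: eq_polyfun (polymx1 i j) => x; rewrite big_nil.
by apply: eq_polyfun (polymxM (pF h) IH i j) => x; rewrite big_cons.
Qed.

End PolynomialFunctions.

Lemma rmorph_red_rat (l k : fieldType) (iota : {rmorphism l -> k}) q :
  iota (red_rat l q) = red_rat k q.
Proof. by rewrite /red_rat fmorph_div !rmorph_int. Qed.

Lemma polymx_artin_hasse_exp (l k : fieldType) (iota : {rmorphism l -> k})
    p d n (X0 : 'M[l]_d) :
  polymx iota (artin_hasse_exp p (n := n) (map_mx iota X0)).
Proof.
apply: polymx_prod => i; apply: polymx_sum => m; apply: polymxZ.
  by apply: eq_polyfun (polyfunC iota n (red_rat l (artin_hasse_coef p m))) => x;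
    apply: rmorph_red_rat.
apply: polymxX; apply: polymxZ; first exact: polyfun_coord.
move=> a b.
by apply: eq_polyfun (polymxX (p ^ i) (polymx_map iota n X0) a b) => x.
Qed.

Lemma map_mpoly_idfun (k : fieldType) n (P : {mpoly k[n]}) : map_mpoly idfun P = P.
Proof. by apply/mpolyP=> m; rewrite mcoeff_map_mpoly. Qed.

Lemma polyfun_idP (k : fieldType) n (F : 'rV[k]_n -> k) :
  polyfun idfun F <-> exists P : {mpoly k[n]}, forall x, F x = P.@[fun j => x 0 j].
Proof. by split=> -[P eP]; exists P => x; rewrite eP map_mpoly_idfun. Qed.

Lemma polyfun_comp (k : fieldType) m n (F : 'rV[k]_n -> k) (G : 'rV[k]_m -> 'rV[k]_n) :
  polyfun idfun F -> polymx idfun G -> polyfun idfun (F \o G).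
Proof.
move=> /polyfun_idP[P eP] pG; apply/polyfun_idP.
have [Q eQ] : exists Q : 'I_n -> {mpoly k[m]}, forall j x, G x 0 j = (Q j).@[fun j => x 0 j].
  by apply: (@fin_all_exists _ (fun=> {mpoly k[m]})
    (fun j q => forall x, G x 0 j = q.@[fun j => x 0 j])) => j; apply/polyfun_idP/pG.
exists (P \mPo [tuple Q i | i < n]) => x.
rewrite comp_mpoly_meval /= eP.
by apply: mpoly.meval_eq => j; rewrite eQ tnth_map tnth_ord_tuple.
Qed.

Lemma polymx_comp (k : fieldType) m n a b (F : 'rV[k]_n -> 'M[k]_(a, b))
    (G : 'rV[k]_m -> 'rV[k]_n) :
  polymx idfun F -> polymx idfun G -> polymx idfun (F \o G).
Proof. by move=> pF pG i j; apply: (polyfun_comp (pF i j) pG). Qed.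

Lemma polymx_cst (k : fieldType) n a b (A : 'M[k]_(a, b)) :
  polymx (n := n) idfun (fun=> A).
Proof. by move=> i j; apply: polyfunC. Qed.

Lemma polymx_vec_mx (k : fieldType) a b :
  polymx idfun (fun x : 'rV[k]_(a * b) => vec_mx x).
Proof.
move=> i j; apply: eq_polyfun (polyfun_coord idfun (mxvec_index i j)) => x.
by rewrite -{1}(vec_mxK x) mxvecE.
Qed.

Lemma polymx_mxvec (k : fieldType) n a b (F : 'rV[k]_n -> 'M[k]_(a, b)) :
  polymx idfun F -> polymx idfun (fun x => mxvec (F x)).
Proof.
move=> pF i j; rewrite (ord1 i); case/mxvec_indexP: j => a' b'.
by apply: eq_polyfun (pF a' b') => x; rewrite mxvecE.
Qed.

Lemma polymx_regular (k : fieldType) m n A (F : 'rV[k]_m -> 'rV[k]_n) :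
  polymx idfun F -> regular_on A F.
Proof.
move=> pF.
have [Q eQ] : exists Q : 'I_n -> {mpoly k[m]}, forall j x, F x 0 j = (Q j).@[fun j => x 0 j].
  by apply: (@fin_all_exists _ (fun=> {mpoly k[m]})
    (fun j q => forall x, F x 0 j = q.@[fun j => x 0 j])) => j; apply/polyfun_idP/pF.
by exists Q => x _ i.
Qed.

(** * Evaluation at nilpotent matrices and invariance of the form *)

Lemma congX_expp (k : fieldType) p (hp : p \in [pchar k]) (P : {poly k}) e :
  P`_0 = 1 -> congX (p ^ e) (P ^+ (p ^ e)) 1.
Proof.
move=> P0; have [D eD] : congX 1 P 1.
  by apply/congXP=> -[|//] _; rewrite P0 coef1.
have hP : p \in [pchar {poly k}] by rewrite pchar_poly.
exists (D ^+ (p ^ e)); rewrite {1}eD expr1 exprDn_pchar ?expr1n ?exprMn //.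
by rewrite pnatX pnatE ?hP // (pcharf_prime hp).
Qed.

Lemma bform_mulmx (R : comNzRingType) n (Phi : 'M[int]_n) (g : 'M[R]_n) u v :
  bform Phi (g *m u) (g *m v) = (u^T *m (g^T *m map_mx intr Phi *m g) *m v) 0 0.
Proof. by rewrite /bform trmx_mul !mulmxA. Qed.

Lemma bform_delta (R : comNzRingType) n (A : 'M[R]_n) i j :
  ((delta_mx i 0 : 'cV_n)^T *m A *m (delta_mx j 0 : 'cV_n)) 0 0 = A i j.
Proof. by rewrite trmx_delta -rowE -colE !mxE. Qed.

Lemma stabSL_mxP (R : comNzRingType) n (Phi : 'M[int]_n) (g : 'M[R]_n) :
  stabSL Phi g <-> \det g = 1 /\ g^T *m map_mx intr Phi *m g = map_mx intr Phi.
Proof.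
split=> -[dg eg]; split=> //.
  apply/matrixP=> i j; have := eg (delta_mx i 0) (delta_mx j 0).
  by rewrite bform_mulmx /bform !bform_delta.
by move=> u v; rewrite bform_mulmx eg.
Qed.

Section Matrices.
Variables (k : fieldType) (d' : nat).
Let d := d'.+1.
Implicit Types X : 'M[k]_d.

(** The minimal polynomial divides a power of the variable, so it is one up to a unit, and its
    degree is at most d by Cayley-Hamilton. *)
Lemma nilpotent_mx_expr X : nilpotent_mx X -> X ^+ d = 0.
Proof.
case=> m Xm; have /dvdp_exp_XsubCP[j lejm] : mxminpoly X %| ('X - 0%:P) ^+ m.
  by apply: mxminpoly_min; rewrite subr0 rmorphXn /= horner_mx_X.
rewrite subr0 => e.
have lejd : (j <= d)%N.
  have := dvdp_leq (monic_neq0 (char_poly_monic X)) (mxminpoly_dvd_char X).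
  by rewrite (eqp_size e) size_polyXn size_char_poly.
have : mxminpoly X %| 'X^d by rewrite (eqp_dvdl _ e) dvdp_exp2l.
by rewrite dvd_mxminpoly rmorphXn /= horner_mx_X => /eqP.
Qed.

Lemma horner_mx_congX X N P Q :
  X ^+ N = 0 -> congX N P Q -> horner_mx X P = horner_mx X Q.
Proof.
move=> XN [D ->].
by rewrite rmorphD rmorphM rmorphXn /= horner_mx_X XN mulr0 addr0.
Qed.

Lemma horner_mx_comp X P Q : horner_mx X (P \Po Q) = horner_mx (horner_mx X Q) P.
Proof.
elim/poly_ind: P => [|P c IH]; first by rewrite comp_poly0 !rmorph0.
rewrite comp_poly_MXaddC !rmorphD !rmorphM /= IH horner_mx_X.
by rewrite !horner_mx_C.
Qed.

Lemma trmx_horner_mx X P : (horner_mx X P)^T = horner_mx X^T P.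
Proof.
elim/poly_ind: P => [|P c IH]; first by rewrite !rmorph0 trmx0.
rewrite !rmorphD !rmorphM /= !horner_mx_X !horner_mx_C linearD /= tr_scalar_mx.
by rewrite trmx_mul IH; congr (_ + _); apply: comm_mx_horner.
Qed.

Lemma horner_mx_intertwine (Psi B C : 'M[k]_d) P : Psi *m B = C *m Psi ->
  Psi *m horner_mx B P = horner_mx C P *m Psi.
Proof.
move=> BC; elim/poly_ind: P => [|P c IH]; first by rewrite !rmorph0 mul0mx mulmx0.
rewrite !rmorphD !rmorphM /= !horner_mx_X !horner_mx_C mulmxDl mulmxDr.
by rewrite mulmxA IH -mulmxA BC mulmxA scalar_mxC.
Qed.

Lemma artin_hasse_horner p X N : X ^+ d = 0 -> (d <= N)%N ->
  artin_hasse p X = horner_mx X (AHk k p N).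
Proof.
move=> Xd ledN; rewrite (@horner_mx_congX X d _ (AHk k p d)) //.
  rewrite /AHk poly_def rmorph_sum; apply: eq_bigr => i _.
  by rewrite /= horner_mxZ rmorphXn /= horner_mx_X.
by apply/congXP=> i ltid; rewrite !coef_poly ltid (leq_trans ltid).
Qed.

(** The order N stays free above d: the addition law needs N >= p^n, and reading the linear
    coefficient of F needs N >= 2. *)
Lemma artin_hasse_exp_horner p n X (t : 'rV[k]_n) N :
    (0 < p)%N -> X ^+ d = 0 -> (d <= N)%N ->
  artin_hasse_exp p X t = horner_mx X (witt_prod p n (AHk k p N) (row_fun t)).
Proof.
move=> p0 Xd ledN; rewrite rmorph_prod; apply: eq_bigr => i _ /=.
rewrite horner_mx_comp horner_mxZ rmorphXn /= horner_mx_X row_funE.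
apply: artin_hasse_horner => //.
by rewrite exprZn -exprM mulnC exprM Xd expr0n expn_eq0 eqn0Ngt p0 scaler0.
Qed.

Section PositiveCharacteristic.
Variable p : nat.
Hypothesis hp : p \in [pchar k].
Let pp : prime p := pcharf_prime hp.
Let p0 : (0 < p)%N := prime_gt0 pp.
Let p1 : (1 < p)%N := prime_gt1 pp.

Lemma artin_hasse_exp_add n X (s t : 'rV[k]_n) : X ^+ d = 0 -> X ^+ (p ^ n) = 0 ->
  artin_hasse_exp p X (witt_add p s t) = artin_hasse_exp p X s *m artin_hasse_exp p X t.
Proof.
move=> Xd Xn; pose N := maxn d (p ^ n).
rewrite !(artin_hasse_exp_horner _ p0 Xd (leq_maxl _ _ : d <= N)%N).
rewrite (horner_mx_congX Xn (AHk_witt_add hp s t (leq_maxr _ _ : p ^ n <= N)%N)).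
by rewrite rmorphM.
Qed.

Lemma horner_mx_expp X (P : {poly k}) : X ^+ d = 0 -> P`_0 = 1 ->
  horner_mx X P ^+ (p ^ d) = 1.
Proof.
move=> Xd P0.
have Xp : X ^+ (p ^ d) = 0.
  by rewrite -(subnK (ltnW (ltn_expl d p1))) exprD Xd mulr0.
rewrite -[LHS](rmorphXn (horner_mx X)) /=.
by rewrite (horner_mx_congX Xp (congX_expp hp d P0)) rmorph1.
Qed.

(** By additivity of Frobenius, (det g - 1)^(p^e) = det g^(p^e) - 1 = 0 in a field. *)
Lemma det_expp (g : 'M[k]_d) e : g ^+ (p ^ e) = 1 -> \det g = 1.
Proof.
move=> /(congr1 determinant); rewrite det1.
have -> : \det (g ^+ (p ^ e)) = \det g ^+ (p ^ e).
  by elim: (p ^ e)%N => [|m IH]; rewrite ?expr0 ?det1 // !exprS det_mulmx IH.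
move=> xp; apply/eqP; rewrite -subr_eq0.
have pe : [pchar k].-nat (p ^ e)%N by rewrite pnatX pnatE ?hp.
have : (\det g - 1) ^+ (p ^ e) == 0.
  by rewrite exprDn_pchar // exprNn_pchar // xp expr1n subrr.
by rewrite expf_eq0 => /andP[].
Qed.

Variable Phi : 'M[int]_d.
Let PhiR : 'M[k]_d := map_mx intr Phi.

Lemma horner_skew X P : X^T *m PhiR = - (PhiR *m X) ->
  (horner_mx X P)^T *m PhiR = PhiR *m horner_mx X (P \Po - 'X).
Proof.
move=> sk; rewrite horner_mx_comp rmorphN /= horner_mx_X trmx_horner_mx.
by symmetry; apply: horner_mx_intertwine; rewrite mulmxN sk.
Qed.

(** Skewness gives P(X)^T Phi P(X) = Phi P(-X) P(X), which is Phi by the congruence. *)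
Lemma horner_stabSL X (P : {poly k}) N : X ^+ d = 0 -> X ^+ N = 0 -> P`_0 = 1 ->
    PhiR = 0 \/ X^T *m PhiR = - (PhiR *m X) /\ congX N ((P \Po - 'X) * P) 1 ->
  stabSL Phi (horner_mx X P).
Proof.
move=> Xd XN P0 hPhi; apply/stabSL_mxP; split.
  exact: det_expp (horner_mx_expp Xd P0).
case: hPhi => [|[sk eP]]; first by rewrite /PhiR => ->; rewrite mulmx0 mul0mx.
rewrite horner_skew // -mulmxA -[X in _ *m X]rmorphM /=.
by rewrite (horner_mx_congX XN eP) rmorph1 mulmx1.
Qed.

Lemma witt_prod_oppr N n (A : {poly k}) z : odd p ->
  congX N ((A \Po - 'X) * A) 1 ->
  congX N ((witt_prod p n A z \Po - 'X) * witt_prod p n A z) 1.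
Proof.
move=> oddp eA; rewrite rmorph_prod -big_split /=.
apply: (@congX_trans _ _ (\prod_(i < n) 1)); last by rewrite big1_eq; exact: congXxx.
apply: congX_prod => i _.
have -> : (A \Po (z i *: 'X^(p ^ i))) \Po - 'X
          = (A \Po - 'X) \Po (z i *: 'X^(p ^ i)).
  rewrite -!comp_polyA; congr (_ \Po _).
  rewrite comp_polyZ rmorphXn rmorphN /= !comp_polyX.
  by rewrite exprNn -signr_odd oddX oddp orbT expr1 mulN1r scalerN.
rewrite -comp_polyM -[X in congX _ _ X](comp_polyC 1 (z i *: 'X^(p ^ i))).
have -> : z i *: 'X^(p ^ i) = (z i *: 'X^((p ^ i).-1)) * 'X.
  by rewrite -scalerAl -exprSr prednK // expn_gt0 p0.
exact: congX_comp.
Qed.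

Lemma artin_hasse_exp_stabSL n X (t : 'rV[k]_n) : X ^+ d = 0 ->
    PhiR = 0 \/ p != 2%N /\ X^T *m PhiR = - (PhiR *m X) ->
  stabSL Phi (artin_hasse_exp p X t).
Proof.
move=> Xd hPhi; rewrite (artin_hasse_exp_horner _ p0 Xd (leqnn d)).
apply: (horner_stabSL Xd Xd); first by rewrite witt_prod_coef0 ?AHk_coef0.
case: hPhi => [|[p2 sk]]; [by left | right; split=> //].
have oddp : odd p by case/even_prime: pp => [p2'|//]; rewrite p2' eqxx in p2.
by apply: witt_prod_oppr => //; apply: AHk_oppr.
Qed.

(** Every factor of index j > i is 1 modulo T^(p^j), and p^j > p^i. *)
Lemma witt_prod_tail n i (A : {poly k}) z : (i < n)%N -> A`_0 = 1 ->
  congX (p ^ i).+1 (witt_prod p n A z) (witt_prod p i.+1 A z).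
Proof.
move=> ltin A0; rewrite -(subnKC ltin); elim: (n - i.+1)%N => [|m IH].
  by rewrite addn0; apply: congXxx.
rewrite addnS; apply: congX_trans IH.
rewrite {1}/witt_prod big_ord_recr /= -/(witt_prod _ _ _ _).
rewrite -[X in congX _ _ X]mulr1; apply: congXM; first exact: congXxx.
have [D ->] : congX 1 A 1 by apply/congXP=> -[|//] _; rewrite A0 coef1.
rewrite comp_polyD comp_polyM rmorph1 expr1 comp_polyX -scalerAr scalerAl.
rewrite -[X in congX _ _ X]addr0; apply: congXD; first exact: congXxx.
by apply: congX_Xn0; rewrite ltn_exp2l //; lia.
Qed.

(* The coordinate [t_i] is read off the coefficient of [X^(p^i)] once         *)
(* [t_0, ..., t_(i-1)] are known.                                             *)
Lemma artin_hasse_exp_coord n X m a b (s t : 'rV[k]_n) (i : 'I_n) :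
    X ^+ d = 0 -> X ^+ m = 0 -> (p ^ i < m)%N ->
    (forall j : 'I_n, s 0 j = if (j < i)%N then t 0 j else 0) ->
    let mu g : k := (X ^+ (m.-1 - p ^ i) *m g) a b in
  mu (artin_hasse_exp p X s) - mu (artin_hasse_exp p X t) = t 0 i * (X ^+ m.-1) a b.
Proof.
move=> Xd Xm ltim es mu; pose N := d.+1.
have N1 : (1 < N)%N by [].
have A0 := AHk_coef0 k p (ltnW N1); have A1 := AHk_coef1 hp N1.
rewrite !(artin_hasse_exp_horner _ p0 Xd (leqnSn d)) -/N.
have e : congX (p ^ i).+1 (witt_prod p n (AHk k p N) (row_fun s) -
     witt_prod p n (AHk k p N) (row_fun t)) (t 0 i *: 'X^(p ^ i)).
  have ct := congX_trans (witt_prod_tail (row_fun t) (ltn_ord i) A0)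
                       (witt_prodS i (row_fun t) p0 A0 A1).
  have cs := congX_trans (witt_prod_tail (row_fun s) (ltn_ord i) A0)
                       (witt_prodS i (row_fun s) p0 A0 A1).
  apply: congX_trans (congXD cs (congXN ct)) _.
  rewrite !row_funE es ltnn scale0r subr0.
  rewrite (eq_witt_prod _ _ (z := row_fun s) (z' := row_fun t)); last first.
    move=> j ltji; have ltjn := ltn_trans ltji (ltn_ord i).
    by rewrite /row_fun !insubT /= es ltji.
  by rewrite opprD addNKr opprK; apply: congXxx.
have subE (g h : 'M[k]_d) c : (c *m g) a b - (c *m h) a b = (c *m (g - h)) a b.
  by rewrite mulmxBr [in RHS]mxE [X in _ = _ + X]mxE.
rewrite /mu subE -rmorphB /=; have [D ->] := e.
rewrite rmorphD rmorphM /= horner_mxZ !rmorphXn /= horner_mx_X mulmxDr.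
have eX j : (X ^+ (m.-1 - p ^ i) *m X ^+ j) = X ^+ (m.-1 - p ^ i + j) by rewrite exprD.
(* The exponents add up to m, so the multiplier in [mu] kills the error term and leaves t_i
   X^(m-1). *)
have -> : X ^+ (m.-1 - p ^ i) *m (horner_mx X D * X ^+ (p ^ i).+1) = 0.
  have -> : horner_mx X D * X ^+ (p ^ i).+1 = X ^+ (p ^ i).+1 * horner_mx X D.
    by apply/commrX/comm_horner_mx.
  rewrite mulmxA eX (_ : (_ + _)%N = m) ?Xm ?mul0mx //; lia.
rewrite addr0 -scalemxAr eX mxE; congr (_ * (X ^+ _) _ _); lia.
Qed.

End PositiveCharacteristic.
End Matrices.

(** * Inversion of a series under composition *)

Section CompositionInverse.
Variable R : comNzRingType.
Implicit Types A V W P Q G : {poly R}.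

(** A first-order Taylor expansion with remainder absorbed in G, whose constant term is A'(0). *)
Lemma comp_polyDr A V W : V`_0 = 0 -> W`_0 = 0 ->
  exists2 G, A \Po (V + W) = (A \Po V) + W * G & G`_0 = A`_1.
Proof.
move=> V0 W0; elim/poly_ind: A => [|A c [G eG G0]].
  by exists 0; rewrite ?comp_poly0 ?mulr0 ?addr0 ?coef0.
exists ((A \Po V) + G * (V + W)).
  by rewrite !comp_poly_MXaddC eG; ring.
rewrite coefD coef0M coefD V0 W0 addr0 mulr0 addr0 coefD coefC addr0.
by rewrite coefMX -horner_coef0 horner_comp horner_coef0 V0 horner_coef0.
Qed.

Lemma congX_cancel N P G : G`_0 = -1 -> congX N (P * G) 0 -> congX N P 0.
Proof.
move=> G0 /congXP e; apply/congXP; elim/ltn_ind=> i IH ltiN.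
have := e i ltiN; rewrite coefM big_ord_recr /= subnn G0 big1 => [|j _].
  by rewrite add0r mulrN1 !coef0 => /eqP; rewrite oppr_eq0 => /eqP.
by rewrite IH ?coef0 ?mul0r // (ltn_trans _ ltiN).
Qed.

Lemma comp_poly_congX_inj N A P Q : A`_1 = -1 -> P`_0 = 0 -> Q`_0 = 0 ->
  congX N (A \Po P) (A \Po Q) -> congX N P Q.
Proof.
move=> A1 P0 Q0 e.
have [|G eG G0] := comp_polyDr A Q0 (W := P - Q); first by rewrite coefB P0 Q0 subrr.
rewrite addrC subrK in eG.
have /congX_cancel : congX N ((P - Q) * G) 0.
  rewrite -[(P - Q) * G](addKr (A \Po Q)) -eG -(addNr (A \Po Q)).
  by apply: congXD; [exact: congXxx | exact: e].
move=> /(_ (etrans G0 A1)) e1; rewrite -[P](subrK Q) -[X in congX _ _ X]add0r.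
by apply: congXD e1 (congXxx _ _).
Qed.

Lemma comp_poly_inverse N A : A`_0 = 1 -> A`_1 = -1 ->
  exists Y, congX N (A \Po (Y * 'X)) (1 + 'X).
Proof.
move=> A0 A1; elim: N => [|[|N] [Y eY]].
- by exists 0; apply/congXP.
- exists 0; apply/congXP=> -[|//] _.
  rewrite mul0r -horner_coef0 horner_comp horner0 horner_coef0 A0.
  by rewrite coefD coef1 coefX addr0.
(* D_0 is the leading error of the current approximation. Since A'(0) = -1, adding it with its own
   sign changes the composite by -D_0 X^(N+1). *)
have [D eD] := eY; exists (Y + D`_0 *: 'X^N).
have XN : 'X^N * 'X = 'X^(N.+1) :> {poly R} by rewrite exprSr.
have [||G eG G0] := comp_polyDr A (V := Y * 'X) (W := D`_0 *: 'X^(N.+1)).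
- by rewrite coefMX.
- by rewrite coefZ coefXn mulr0.
rewrite mulrDl -scalerAl XN eG eD; apply/congXP=> i.
rewrite ltnS leq_eqVlt -addrA coefD => /orP[/eqP->|lti].
  rewrite [X in _ + X]coefD coefMXn ltnn subnn -scalerAl coefZ ['X^_ * _]mulrC coefMXn.
  by rewrite ltnn subnn G0 A1 mulrN1 subrr addr0.
rewrite [X in _ + X]coefD coefMXn lti -scalerAl coefZ ['X^_ * _]mulrC coefMXn lti.
by rewrite mulr0 !addr0.
Qed.

End CompositionInverse.

(** * Logarithms of unipotent elements and the polynomial inverse of E_X *)

Section Unipotent.
Variables (k : fieldType) (d' : nat) (p : nat).
Let d := d'.+1.
Hypothesis hp : p \in [pchar k].
Let pp : prime p := pcharf_prime hp.
Variable Phi : 'M[int]_d.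
Let PhiR : 'M[k]_d := map_mx intr Phi.

(** X = V(u - 1), where A(V(T)) = 1 + T. For p odd, A(-X) is the inverse of u, and invariance of the
    form under u then transfers through V to skewness of X. *)
Lemma unipotent_artin_hasse (u : 'M[k]_d) :
    unipotent_mx u -> stabSL Phi u -> PhiR = 0 \/ p != 2%N ->
  exists X : 'M[k]_d, [/\ X ^+ d = 0, artin_hasse p X = u &
    PhiR = 0 \/ p != 2%N /\ X^T *m PhiR = - (PhiR *m X)].
Proof.
move=> /nilpotent_mx_expr; set Z := u - 1%:M => Zd /stabSL_mxP[_ eu] hPhi.
pose N := d.+1; pose A := AHk k p N.
have N1 : (1 < N)%N by [].
have A0 : A`_0 = 1 := AHk_coef0 k p (ltnW N1).
have A1 : A`_1 = -1 := AHk_coef1 hp N1.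
have [Y eY] := comp_poly_inverse N A0 A1; set V := Y * 'X in eY.
have ZN : Z ^+ N = 0 by rewrite exprS Zd mulr0.
pose X := horner_mx Z V.
have Xd : X ^+ d = 0.
  by rewrite /X /V -rmorphXn exprMn rmorphM !rmorphXn /= horner_mx_X Zd mulr0.
have Au : horner_mx X A = u.
  rewrite -horner_mx_comp (horner_mx_congX ZN eY) rmorphD rmorph1 /= horner_mx_X.
  by rewrite /Z addrC subrK.
exists X; split=> //; first by rewrite (artin_hasse_horner p Xd (leqnSn d)).
case: hPhi => [|p2]; [by left | right; split=> //].
(* V is also a left inverse: A(V(B)) = 1 + B = A, and A can be cancelled because A'(0) = -1 is
   invertible. *)
pose B := A - 1; have VB : congX N (V \Po B) 'X.
  have B0 : B`_0 = 0 by rewrite coefB A0 coef1 subrr.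
  apply: (comp_poly_congX_inj A1); rewrite ?coefX //.
    by rewrite -horner_coef0 horner_comp horner_coef0 B0 horner_coef0 coefMX.
  rewrite comp_polyA comp_polyXr.
  have [B1 eB] : exists B1, B = B1 * 'X.
    have [B1 eB] : congX 1 B 0 by apply/congXP=> -[|//] _; rewrite B0 coef0.
    by exists B1; rewrite eB add0r.
  have := congX_comp B1 eY; rewrite -eB; congr (congX _ _ _).
  by rewrite comp_polyD rmorph1 /= comp_polyX addrC subrK.
have XN : X ^+ N = 0 by rewrite exprS Xd mulr0.
have XtN : (- X^T) ^+ N = 0.
  have tX m : X^T ^+ m = (X ^+ m)^T.
    elim: m => [|m IH]; first by rewrite !expr0 trmx1.
    by rewrite exprS exprSr IH; exact/esym/trmx_mul.
  by rewrite exprNn tX XN trmx0 mulr0.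
pose w := horner_mx X (A \Po - 'X).
have wu : w *m u = 1%:M.
  rewrite -Au /w -[LHS]rmorphM /=.
  by rewrite (horner_mx_congX XN (AHk_oppr hp p2 (ltnW N1))) rmorph1.
have uw : u *m w = 1%:M by exact: mulmx1C.
(* Since w is the inverse of u, invariance moves u across the form as w^T. Thus Z corresponds to
   B(-X^T), and applying V to both turns Z into X and B(-X^T) into -X^T. *)
have Phiu : PhiR *m u = w^T *m PhiR.
  rewrite -[PhiR in RHS]eu -/PhiR !mulmxA -trmx_mul uw trmx1 mul1mx.
  by [].
have PhiZ : PhiR *m Z = (w^T - 1) *m PhiR.
  by rewrite mulmxBr mulmx1 Phiu mulmxBl mul1mx.
have wB : w^T - 1 = horner_mx (- X^T) B.
  rewrite rmorphB rmorph1 /=; congr (_ - _).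
  by rewrite trmx_horner_mx horner_mx_comp rmorphN /= horner_mx_X.
have := horner_mx_intertwine V PhiZ; rewrite -/X wB -horner_mx_comp.
by rewrite (horner_mx_congX XtN VB) horner_mx_X mulNmx => ->; rewrite opprK.
Qed.

(** With m the nilpotency index of X, a nonzero entry (a, b) of X^(m-1) serves as divisor in
    [artin_hasse_exp_coord], which yields the coordinates one after the other. *)
Lemma artin_hasse_exp_inverse n (X : 'M[k]_d) :
    X ^+ d = 0 -> p_nilpotence_degree p X n ->
  exists2 r : 'rV[k]_(d * d) -> 'rV[k]_n, polymx idfun r &
    forall t, r (mxvec (artin_hasse_exp p X t)) = t.
Proof.
move=> Xd [Xn minn]; have p0 := prime_gt0 pp.
have ex_m : exists m, X ^+ m == 0 by exists d; apply/eqP.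
pose m := ex_minn ex_m.
have [Xm minm] : X ^+ m = 0 /\ forall m', X ^+ m' = 0 -> (m <= m')%N.
  rewrite /m; case: ex_minnP => m0 /eqP Xm0 min0; split=> // m' /eqP; exact: min0.
have m_gt0 : (0 < m)%N.
  rewrite lt0n; apply/eqP=> m0; move: Xm; rewrite m0 expr0 => /eqP.
  by rewrite oner_eq0.
have /matrix0Pn[a [b Xab]] : X ^+ m.-1 != 0.
  by apply/eqP=> /minm; rewrite leqNgt prednK // leqnn.
have ltpm (i : 'I_n) : (p ^ i < m)%N.
  rewrite ltnNge; apply/negP=> lem; have : X ^+ (p ^ i) = 0.
    by rewrite -(subnK lem) exprD Xm mulr0.
  by move/minn; rewrite leqNgt ltn_ord.
have pE : polymx idfun (artin_hasse_exp p (n := n) X).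
  have := polymx_artin_hasse_exp idfun p n X.
  by rewrite map_mx_id.
(* At stage i the map r recovers the coordinates below i and puts 0 elsewhere, which is the vector s
   required by [artin_hasse_exp_coord]. *)
suff ind i : (i <= n)%N -> exists2 r : 'rV[k]_(d * d) -> 'rV[k]_n, polymx idfun r &
    forall t j, r (mxvec (artin_hasse_exp p X t)) 0 j = if (j < i)%N then t 0 j else 0.
  have [r pr er] := ind n (leqnn n).
  by exists r => // t; apply/rowP=> j; rewrite er ltn_ord.
elim: i => [|i IH] lein.
  by exists (fun=> 0) => [|t j]; [exact: polymx_cst | rewrite mxE].
have [r pr er] := IH (ltnW lein); pose i' := Ordinal lein.
pose mu (g : 'M[k]_d) : k := (X ^+ (m.-1 - p ^ i) *m g) a b.
pose c := (X ^+ m.-1) a b.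
exists (fun x => r x + ((mu (artin_hasse_exp p X (r x)) - mu (vec_mx x)) * c^-1)
                       *: delta_mx 0 i').
  apply: polymxD => //; apply: polymxZ; last exact: polymx_cst.
  have pmu (F : 'rV[k]_(d * d) -> 'M[k]_d) :
      polymx idfun F -> polyfun idfun (fun x => mu (F x)).
    by move=> pF; apply: (polymxM (polymx_cst _ _) pF).
  apply: polyfunM; last exact: (polyfunC idfun).
  apply: polyfunD; first by apply: pmu; apply: (polymx_comp pE pr).
  by apply: polyfunN; apply: pmu; apply: polymx_vec_mx.
move=> t j; rewrite mxvecK !mxE er eqxx /=.
have := artin_hasse_exp_coord hp a b (i := i') Xd Xm (ltpm i') (er t).
rewrite /= -/(mu _) -/(mu _) => ->; rewrite -/c mulfK //.
rewrite -val_eqE /= ltnS; case: ltngtP => [ltji|ltij|eji].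
- by rewrite mulr0 addr0.
- by rewrite mulr0 addr0.
by rewrite mulr1 add0r; congr (t _ _); apply: val_inj.
Qed.

Lemma p_nilpotence_degree_exists (X : 'M[k]_d) :
  X ^+ d = 0 -> exists n, p_nilpotence_degree p X n.
Proof.
move=> Xd; have ex_n : exists n, X ^+ (p ^ n) == 0.
  exists d; rewrite -(subnK (ltnW (ltn_expl d (prime_gt1 pp)))) exprD Xd mulr0.
  exact: eqxx.
exists (ex_minn ex_n); case: ex_minnP => n /eqP Xn minn; split=> // m /eqP; exact: minn.
Qed.

End Unipotent.

(** * The Lie algebra through dual numbers *)

Lemma infinitesimal_isometry (D : comNzRingType) n (eps : D) (A X : 'M[D]_n) :
    eps * eps = 0 ->
    (1%:M + eps *: X)^T *m A *m (1%:M + eps *: X) = A ->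
  eps *: (X^T *m A + A *m X) = 0.
Proof.
move=> eps2; have -> : (1%:M + eps *: X)^T = 1%:M + eps *: X^T.
  by rewrite linearD linearZ /= trmx1.
rewrite mulmxDl mul1mx mulmxDr mulmx1.
rewrite -scalemxAl -scalemxAr mulmxDl -scalemxAl scalerDr scalerA eps2 scale0r addr0.
by rewrite -addrA -scalerDr -[RHS]addr0 => /addrI.
Qed.

Section DualNumbers.
Variable R : comNzRingType.
Let D : comNzRingType := {poly %/ ('X^2 : {poly R})}.
Let iota : {rmorphism R -> D} := in_qpoly ('X^2 : {poly R}) \o polyC.
Let eps : D := 'qX.

Lemma dual_eps_sqr : eps * eps = 0.
Proof.
rewrite /eps /qpolyX -[LHS](rmorphM (in_qpoly ('X^2 : {poly R}))) -expr2.
by apply: val_inj; rewrite /= mk_monic_Xn Pdiv.RingMonic.rmodpp ?monicXn.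
Qed.

Lemma dual_eps_inj x : eps * iota x = 0 -> x = 0.
Proof.
rewrite /eps /qpolyX /iota /= -[LHS](rmorphM (in_qpoly ('X^2 : {poly R}))).
move=> /(congr1 (fun q : D => (q : {poly R})`_1)).
rewrite in_qpoly_small ?mk_monic_Xn.
  by rewrite coefMC coefX mul1r coef0.
rewrite size_polyXn (leq_ltn_trans (size_polyMleq _ _)) // size_polyX.
by rewrite size_polyC; case: (_ != _).
Qed.

(** This is the coefficient of eps in the isometry condition for 1 + eps X; multiplication by eps is
    injective on R. *)
Lemma Lie_skew n (Phi : 'M[int]_n) (X : 'M[R]_n) : Lie Phi X ->
  X^T *m map_mx intr Phi = - (map_mx intr Phi *m X).
Proof.
rewrite /Lie stabSL_mxP -/eps -[fun a => _]/(iota : R -> D) => -[_].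
set A : 'M[R]_n := map_mx intr Phi.
have -> : map_mx intr Phi = map_mx iota A.
  by apply/matrixP=> i j; rewrite !mxE rmorph_int.
move/(infinitesimal_isometry dual_eps_sqr) => e.
apply/eqP; rewrite -addr_eq0; apply/eqP/matrixP=> i j.
rewrite [RHS]mxE; apply: dual_eps_inj.
move/matrixP/(_ i j): e; rewrite map_trmx -!map_mxM -map_mxD.
by rewrite !mxE.
Qed.

End DualNumbers.

(** * Assembly: the morphism E_X, its image, and unipotent elements *)

Section Main.
Variables (k : fieldType) (d' p : nat).
Let d := d'.+1.
Hypothesis hp : p \in [pchar k].
Let pp : prime p := pcharf_prime hp.
Variable Phi : 'M[int]_d.
Let PhiR : 'M[k]_d := map_mx intr Phi.

Lemma artin_hasse_exp_morphism n (X : 'M[k]_d) :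
    X ^+ d = 0 -> X ^+ (p ^ n) = 0 ->
    PhiR = 0 \/ p != 2%N /\ X^T *m PhiR = - (PhiR *m X) ->
  witt_morphism p (@stabSL d Phi k) (artin_hasse_exp p (n := n) X).
Proof.
move=> Xd Xn hPhi; split=> [t||s t].
- exact: artin_hasse_exp_stabSL.
- apply/polymx_regular/polymx_mxvec.
  by have := polymx_artin_hasse_exp idfun p n X; rewrite map_mx_id.
exact: artin_hasse_exp_add.
Qed.

Lemma artin_hasse_exp_expp n (X : 'M[k]_d) (t : 'rV[k]_n) : X ^+ d = 0 ->
  artin_hasse_exp p X t ^+ (p ^ d) = 1.
Proof.
move=> Xd; rewrite (artin_hasse_exp_horner _ (prime_gt0 pp) Xd (leqnn d)).
apply: horner_mx_expp => //.
by rewrite witt_prod_coef0 ?AHk_coef0 // prime_gt0.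
Qed.

(** If r is a polynomial left inverse of E, then g is in the image exactly when E(r(g)) = g, a
    system of polynomial equations in the entries of g; r itself is the regular inverse. *)
Lemma artin_hasse_exp_image n (X : 'M[k]_d) :
    X ^+ d = 0 -> p_nilpotence_degree p X n ->
    PhiR = 0 \/ p != 2%N /\ X^T *m PhiR = - (PhiR *m X) ->
  let H g := exists t : 'rV[k]_n, g = artin_hasse_exp p X t in
  closed_subgroup (@stabSL d Phi k) H /\ witt_isomorphic p n H.
Proof.
move=> Xd degX hPhi H; have [Xn _] := degX.
have [r pr er] := artin_hasse_exp_inverse hp Xd degX.
set E := artin_hasse_exp p (n := n) X in er *.
have [EG regE Eadd] := artin_hasse_exp_morphism Xd Xn hPhi.
have pE : polymx idfun E.
  by have := polymx_artin_hasse_exp idfun p n X; rewrite map_mx_id.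
have HP g : H g <-> E (r (mxvec g)) = g.
  by split=> [[t ->]|<-]; [rewrite er | exists (r (mxvec g))].
have HM g h : H g -> H h -> H (g *m h).
  by move=> [s ->] [t ->]; exists (witt_add p s t); rewrite -Eadd.
have HX g m : H g -> H (g ^+ m.+1).
  by move=> Hg; elim: m => [//|m IH]; rewrite exprS; apply: HM.
(* With p^d = m + 2 the identity and the inverse of g are positive powers, g^(m+2) and g^(m+1), so
   closure under products yields both. *)
have [m em] : exists m, (p ^ d = m.+2)%N.
  exists (p ^ d).-2; have : (1 < p ^ d)%N by rewrite -{1}(expn0 p) ltn_exp2l ?prime_gt1.
  by case: (p ^ d)%N => [|[]].
have gX g : H g -> g ^+ m.+2 = 1 by move=> [t ->]; rewrite -em artin_hasse_exp_expp.
split.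
  split=> //.
  - by move=> g [t ->].
  - exists (fun f : {mpoly k[d * d]} => exists i j, forall x : 'rV[k]_(d * d),
      f.@[fun h => x 0 h] = (E (r x) - vec_mx x) i j).
    move=> g; rewrite HP; split=> [eg f [i [j ->]]|eI].
      by rewrite mxvecK eg subrr mxE.
    apply/eqP; rewrite -subr_eq0; apply/eqP/matrixP=> i j.
    have /polyfun_idP[f ef] : polyfun idfun (fun x => (E (r x) - vec_mx x) i j).
      have pvec : polyfun idfun (fun x : 'rV[k]_(d * d) => vec_mx x i j).
        exact: polymx_vec_mx.
      have pEr : polyfun idfun (fun x => E (r x) i j) := polymx_comp pE pr i j.
      apply: eq_polyfun (polyfunD pEr (polyfunN pvec)) => x.
      by rewrite !mxE.
    rewrite [RHS]mxE -(eI f); first by rewrite -ef mxvecK.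
    by exists i, j => x; rewrite ef.
  - by have H0 : H (E 0) by [exists 0]; have := HX _ m.+1 H0; rewrite gX.
  - move=> g Hg; have ug : g *m g ^+ m.+1 = 1%:M by rewrite -[LHS]exprS gX.
    suff -> : invmx g = g ^+ m.+1 by apply: HX.
    by rewrite -[LHS]mulmx1 -ug mulKmx //; case: (mulmx1_unit ug).
exists E, (fun g => r (mxvec g)); split=> //.
- by split=> // t; exists t.
- by move=> g /HP.
apply: polymx_regular => i j; apply: eq_polyfun (pr i j) => x.
by rewrite vec_mxK.
Qed.

Lemma unipotent_witt_subgroup (u : 'M[k]_d) : PhiR = 0 \/ p != 2%N ->
  stabSL Phi u -> unipotent_mx u ->
  exists (n : nat) (H : 'M[k]_d -> Prop),
    [/\ closed_subgroup (@stabSL d Phi k) H, H u & witt_isomorphic p n H].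
Proof.
move=> hPhi Gu uu.
have [X [Xd eu sk]] := unipotent_artin_hasse hp uu Gu hPhi.
have [n degX] := p_nilpotence_degree_exists hp Xd.
have [clH isoH] := artin_hasse_exp_image Xd degX sk.
exists n; eexists; split; [exact: clH | | exact: isoH].
(* E_X(1, 0, ..., 0) = F(X) = u. *)
pose t : 'rV[k]_n := \row_i (i == 0 :> nat)%:R; exists t.
have ah0 : artin_hasse p (0 : 'M[k]_d) = 1.
  rewrite /artin_hasse big_ord_recl big1 => [|i _].
    have := AHk_coef0 k p (ltn0Sn d'); rewrite coef_poly /= => ->.
    by rewrite expr0 addr0 scale1r.
  by rewrite expr0n scaler0.
(* For n = 0 there is no first coordinate, but then X = 0 and u = F(0) = 1 is the empty product. *)
case: n degX @t {clH isoH} => [|n] degX t.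
  rewrite /artin_hasse_exp big_ord0 -eu.
  by have [X1 _] := degX; rewrite expn0 expr1 in X1; rewrite X1.
rewrite /artin_hasse_exp big_ord_recl big1 => [|i _].
  by rewrite mxE expn0 scale1r expr1 mulr1.
by rewrite mxE scale0r.
Qed.

End Main.

Theorem proposition7p5 (k : closedFieldType) (p : nat) (hp : p \in [pchar k])
    (c : classical_type) (d : nat) (Phi : 'M[int]_d)
    (hG : classical_datum c Phi) (hgood : good_prime c p) :
  (forall (X : 'M[k]_d) (n : nat),
     Lie Phi X -> nilpotent_mx X -> p_nilpotence_degree p X n ->
     [/\ witt_morphism p (@stabSL d Phi k) (artin_hasse_exp p (n := n) X),
         injective (artin_hasse_exp p (n := n) X) &
         forall (l : fieldType) (iota : {rmorphism l -> k}) (X0 : 'M[l]_d),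
           Lie_Fp_ext Phi p X0 -> X = map_mx iota X0 ->
           defined_over iota (artin_hasse_exp p (n := n) X)])
  /\
  (forall u : 'M[k]_d, stabSL Phi u -> unipotent_mx u ->
     exists (n : nat) (H : 'M[k]_d -> Prop),
       [/\ closed_subgroup (@stabSL d Phi k) H, H u & witt_isomorphic p n H]).
Proof.
(* Each type forces d > 0, so that the square matrices form a nonzero ring. *)
case: d Phi hG => [|d] Phi [_ hG]; first by case: c hG {hgood} => [[]|[]|[]].
(* This dichotomy is all that remains of the type: a zero form imposes no condition, and otherwise p
   is odd. *)
have hPhi : map_mx intr Phi = 0 :> 'M[k]_d.+1 \/ p != 2%N.
  case: c hG hgood => [[_ ->] _|_ /eqP|_ /eqP]; [left | by right | by right].
  by apply/matrixP=> i j; rewrite !mxE.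
split=> [X n LX /nilpotent_mx_expr Xd degX|u]; last exact: unipotent_witt_subgroup.
have [Xn _] := degX; split.
- apply: artin_hasse_exp_morphism => //.
  by case: hPhi => [|p2]; [left | right; split; last exact: Lie_skew].
- have [r _ er] := artin_hasse_exp_inverse hp Xd degX.
  exact: (can_inj (g := fun g => r (mxvec g)) er).
move=> l iota X0 _ eX; have pE := polymx_artin_hasse_exp iota p n X0.
rewrite -eX in pE.
have [P eP] := fin_all_exists (fun i => fin_all_exists (pE i)).
by exists P => t i j; rewrite eP.
Qed.
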